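(* Let $T$ be a tree in which every vertex has degree at most $3$, and let $\mathcal{R}$ be a finite multiset of rooted subtrees of $T$. Then the algorithm GREEDY-COL (described in the context), run on $(T,\mathcal{R})$, outputs a valid coloring $\psi^{\mathrm{GDY}}$ of $\mathcal{R}$ whose number of colors satisfies $$|\psi^{\mathrm{GDY}}(\mathcal{R})|\le \tfrac{5}{2}\,\min_{\psi\in\Psi_{\mathcal{R}}}|\psi(\mathcal{R})|,$$ where $\Psi_{\mathcal{R}}$ is the set of all valid colorings of $\mathcal{R}$. This holds for every way of resolving the arbitrary choices in the algorithm (BFS root and order, choice of maximum matchings, order in which subtrees are picked).
   Context: A directed graph $\vec{R}$ is a rooted tree if its underlying undirected (multi)graph is a tree, there is a unique vertex of in-degree $0$, and every other vertex has in-degree $1$. $\vec{R}$ is a rooted subtree of a tree $T$ if it is a rooted tree whose underlying undirected graph is a subtree of $T$. Two rooted subtrees collide if they share a directed edge $(a,b)$. A valid coloring of a multiset $\mathcal{R}$ of rooted subtrees is a map $\psi:\mathcal{R}\to\mathbb{N}=\{1,2,\dots\}$ with $\psi(\vec{R})\ne\psi(\vec{S})$ whenever $\vec{R},\vec{S}$ collide; $\psi(\mathcal{S})$ denotes the image of a subset $\mathcal{S}$. For an edge $\{a,b\}$ of $T$ and a multiset $\mathcal{S}$, $\mathcal{S}[\{a,b\}]$ is the sub-multiset of members containing $(a,b)$ or $(b,a)$. ''First-fit coloring'' of a subtree means assigning it the smallest positive integer not used by any already-colored subtree colliding with it. GREEDY-COL: Run BFS on $T$ from an arbitrary root and list the edges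 $e_1,\dots,e_m$ in order of discovery. Set $\mathcal{P}_0=\emptyset$. For $i=1,\dots,m$: let $e_i=\{u,v\}$ with $u$ discovered before $v$, and $\mathcal{Q}_i=\mathcal{R}[e_i]\setminus\mathcal{P}_{i-1}$. Call $e_i$ of type 4 if $u$ has degree $3$ with other incident edges $\{u,w\},\{u,x\}$ where $\{u,w\}=e_j$ with $j<i$ and $\{u,x\}=e_k$ with $k>i$. If $e_i$ is not of type 4, first-fit color the members of $\mathcal{Q}_i$ one at a time in arbitrary order. If $e_i$ is of type 4, compute two extensions $\psi_1,\psi_2$ of the current coloring of $\mathcal{P}_{i-1}$ to $\mathcal{P}_{i-1}\cup\mathcal{Q}_i$ by PROCESS-EDGE-1 and PROCESS-EDGE-2 below, and adopt $\psi_1$ on $\mathcal{Q}_i$ if $|\psi_1(\mathcal{P}_{i-1}\cup\mathcal{Q}_i)|\le|\psi_2(\mathcal{P}_{i-1}\cup\mathcal{Q}_i)|$, otherwise $\psi_2$. Then set $\mathcal{P}_i=\mathcal{P}_{i-1}\cup\mathcal{Q}_i$. PROCESS-EDGE-1 (with $\mathcal{P}=\mathcal{P}_{i-1}$ colored by $\psi$, $\mathcal{Q}=\mathcal{Q}_i$): form graph $B_1$ on vertex set $\mathcal{P}[\{u,v\}]\cup\mathcal{Q}$ containing all edges between colliding pairs, and additionally an edge between a non-colliding pair $\vec{R},\vec{S}$ if either both lie in $\mathcal{P}$ and $\psi(\vec{R})\ne\psi(\vec{S})$, or $\vec{R}\in\mathcal{Q}$, $\vec{S}\in\mathcal{P}$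 and some $\vec{U}\in\mathcal{P}$ with $\psi(\vec{U})=\psi(\vec{S})$ collides with $\vec{R}$. Take a maximum matching $M$ in the complement $\bar B_1$ (which is bipartite). For each matched pair $\{\vec{R},\vec{S}\}$ with $\vec{R}\in\mathcal{Q},\vec{S}\in\mathcal{P}$ set $\psi(\vec{R})=\psi(\vec{S})$. Then while some $\vec{R}\in\mathcal{Q}$ is uncolored: if $\vec{R}$ is matched in $M$ to $\vec{S}$, give both $\vec{R},\vec{S}$ the smallest positive integer not used by any colored subtree colliding with $\vec{R}$ or $\vec{S}$; otherwise first-fit color $\vec{R}$. PROCESS-EDGE-2: same construction with vertex set $(\mathcal{P}[\{u,x\}]\setminus\mathcal{P}[\{u,v\}])\cup\mathcal{Q}[\{u,x\}]$ (graph $B_2$, maximum matching in $\bar B_2$); after assigning matched partners' colors, process uncolored $\vec{R}\in\mathcal{Q}[\{u,x\}]$ as in PROCESS-EDGE-1 (pairs colored jointly, unmatched ones first-fit), and finally first-fit color all remaining uncolored members of $\mathcal{Q}$ one at a time.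
   Formalization: Single-vertex rooted subtrees contain no edge, so GREEDY-COL never colors them; validity and the number of colors of the output are therefore stated for the members of R having at least one edge, while the minimum is over valid colorings of all of R. *)

(* Defs.v *)
From HB Require Import structures.
From mathcomp Require Import all_boot all_order all_algebra.
Set Implicit Arguments.
Unset Strict Implicit.
Unset Printing Implicit Defensive.

Section Trees.
Variable V : finType.

Definition is_tree (S : {set V}) (e : rel V) : Prop :=
  [/\ S != set0,
      symmetric e /\ irreflexive e,
      forall x y, e x y -> (x \in S) && (y \in S),
      {in S &, forall x y, connect e x y}
    & forall c : seq V, 2 < size c -> ~ ucycle e c].

Definition neighbors (e : rel V) (x : V) : {set V} := [set y | e x y].

Definition max_degree_le (e : rel V) (d : nat) : Prop :=
  forall x, #|neighbors e x| <= d.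

Record digraph : Type := Digraph { verts : {set V}; arcs : {set V * V} }.

Definition underlying (G : digraph) : rel V :=
  fun x y => ((x, y) \in arcs G) || ((y, x) \in arcs G).

Definition indegree (G : digraph) (x : V) : nat :=
  #|[set y | (y, x) \in arcs G]|.

(* The underlying undirected multigraph of [G] is a tree when it has no
   parallel edges (no two opposite arcs) and its underlying simple graph is a
   tree.  *)
Definition rooted_tree (G : digraph) : Prop :=
  [/\ is_tree (verts G) (underlying G),
      forall x y, (x, y) \in arcs G -> (y, x) \notin arcs G
    & exists r, [/\ r \in verts G, indegree G r = 0
        & {in verts G, forall x, x != r -> indegree G x = 1}]].

Definition rooted_subtree (e : rel V) (G : digraph) : Prop :=
  rooted_tree G /\ subrel (underlying G) e.

(* [bfs_from e q D E]: breadth-first search resumed with queue [q] and set of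
   discovered vertices [D] discovers the edges [E], in this order.  A vertex
   [u] taken from the queue discovers its undiscovered neighbors in an
   arbitrary order [s]; the edge is recorded as [(u, v)], where [u] is
   discovered before [v].  *)
Inductive bfs_from (e : rel V) :
    seq V -> {set V} -> seq (V * V) -> Prop :=
| bfs_empty (D : {set V}) : bfs_from e [::] D [::]
| bfs_visit u q (D : {set V}) s E :
    uniq s -> s =i neighbors e u :\: D ->
    bfs_from e (q ++ s) (D :|: [set v in s]) E ->
    bfs_from e (u :: q) D ([seq (u, v) | v <- s] ++ E).

Definition bfs_order (e : rel V) (E : seq (V * V)) : Prop :=
  exists root, bfs_from e [:: root] [set root] E.

Definition listed (E : seq (V * V)) (a b : V) : bool :=
  ((a, b) \in E) || ((b, a) \in E).

(* [{u, v}] is of type 4, with [{u, x}] the edge at [u] that comes later; [pre]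
   and [post] list the edges before and after [{u, v}].  *)
Definition type4 (e : rel V) (pre post : seq (V * V)) (u v x : V) : bool :=
  (#|neighbors e u| == 3) &&
  [exists w, [&& neighbors e u == [set v; w; x],
                 listed pre u w & listed post u x]].

End Trees.

(* A finite multiset of digraphs is a family [R : I -> digraph V] indexed by a
   finite type, and a sub-multiset is a set of indices.  *)
Section Colorings.
Variables (V I : finType) (R : I -> digraph V).
Implicit Types (S P Q W A : {set I}) (r s t : I) (M : {set {set I}}).

Definition collide r s : bool := arcs (R r) :&: arcs (R s) != set0.

Definition on_edge S (a b : V) : {set I} :=
  [set r in S | underlying (R r) a b].

(* Colors are the positive integers.  A partial coloring is a function into
   [nat] where the value [0] means that the member is uncolored.  *)
Local Notation coloring := {ffun I -> nat}.
Implicit Types psi : coloring.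

Definition valid_coloring S psi : Prop :=
  {in S, forall r, 0 < psi r} /\
  {in S &, forall r s, r != s -> collide r s -> psi r != psi s}.

Definition ncolors psi S : nat := size (undup [seq psi r | r in S]).

Definition min_ncolors S (k : nat) : Prop :=
  (exists2 psi, valid_coloring S psi & ncolors psi S = k) /\
  (forall psi, valid_coloring S psi -> k <= ncolors psi S).

Definition recolor psi A (c : nat) : coloring :=
  [ffun r => if r \in A then c else psi r].

Definition free_color psi A (c : nat) : bool :=
  (0 < c) && [forall r in A, forall t, collide t r ==> (psi t != c)].

Definition first_free psi A (c : nat) : Prop :=
  free_color psi A c /\ (forall d, free_color psi A d -> c <= d).

(* The coloring loop run on the members of [Q], in an arbitrary order: from
   [psi] it may end in the last argument.  *)
Inductive color_loop M Q : coloring -> coloring -> Prop :=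
| loop_done psi :
    {in Q, forall r, psi r != 0} -> color_loop M Q psi psi
| loop_pair psi psi' r s c :
    r \in Q -> psi r = 0 -> [set r; s] \in M ->
    first_free psi [set r; s] c ->
    color_loop M Q (recolor psi [set r; s] c) psi' ->
    color_loop M Q psi psi'
| loop_single psi psi' r c :
    r \in Q -> psi r = 0 -> r \notin cover M ->
    first_free psi [set r] c ->
    color_loop M Q (recolor psi [set r] c) psi' ->
    color_loop M Q psi psi'.

Definition first_fit_all Q : coloring -> coloring -> Prop :=
  color_loop set0 Q.

Definition blocked P Q psi r s : bool :=
  [&& r \in Q, s \in P
    & [exists t in P, (psi t == psi s) && collide t r]].

(* Two members in conflict are adjacent in the auxiliary graph; its vertex set
   [W] enters only in [compl_adj], the adjacency of the complement.  *)
Definition conflict P Q psi r s : bool :=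
  [|| collide r s,
      [&& r \in P, s \in P & psi r != psi s],
      blocked P Q psi r s
    | blocked P Q psi s r].

Definition compl_adj P Q psi W : rel I :=
  fun r s => [&& r \in W, s \in W, r != s & ~~ conflict P Q psi r s].

Definition matching (adj : rel I) M : Prop :=
  trivIset M /\
  {in M, forall p, exists r s, adj r s /\ p = [set r; s]}.

Definition maximum_matching (adj : rel I) M : Prop :=
  matching adj M /\ (forall M', matching adj M' -> #|M'| <= #|M|).

Definition copy_colors P Q M psi : coloring :=
  [ffun r => if r \in Q then
               if [pick s in P | [set r; s] \in M] is Some s then psi s
               else psi r
             else psi r].

Definition process_edge1 P Q (u v : V) psi psi' : Prop :=
  exists2 M,
    maximum_matching (compl_adj P Q psi (on_edge P u v :|: Q)) M
  & color_loop M Q (copy_colors P Q M psi) psi'.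

Definition process_edge2 P Q (u v x : V) psi psi' : Prop :=
  let Px := on_edge P u x :\: on_edge P u v in
  let Qx := on_edge Q u x in
  exists M psi'',
  [/\ maximum_matching (compl_adj P Q psi (Px :|: Qx)) M,
      color_loop M Qx (copy_colors P Qx M psi) psi''
    & first_fit_all Q psi'' psi'].

Inductive edge_step (e : rel V) (pre post : seq (V * V)) P Q (u v : V) psi :
    coloring -> Prop :=
| step_simple psi' :
    (forall x, ~~ type4 e pre post u v x) ->
    first_fit_all Q psi psi' ->
    edge_step e pre post P Q u v psi psi'
| step_type4 x psi1 psi2 :
    type4 e pre post u v x ->
    process_edge1 P Q u v psi psi1 ->
    process_edge2 P Q u v x psi psi2 ->
    edge_step e pre post P Q u v psi
      (if ncolors psi1 (P :|: Q) <= ncolors psi2 (P :|: Q)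
       then psi1 else psi2).

(* [greedy_from e pre P post psi psi']: after the edges [pre], which have
   colored [P] by [psi], treating the edges [post] may end in [psi'].  *)
Inductive greedy_from (e : rel V) :
    seq (V * V) -> {set I} -> seq (V * V) -> coloring -> coloring -> Prop :=
| greedy_end pre P psi : greedy_from e pre P [::] psi psi
| greedy_edge pre P u v post psi psi1 psi' :
    let Q := on_edge setT u v :\: P in
    edge_step e pre post P Q u v psi psi1 ->
    greedy_from e (rcons pre (u, v)) (P :|: Q) post psi1 psi' ->
    greedy_from e pre P ((u, v) :: post) psi psi'.

Definition greedy_col (e : rel V) psi : Prop :=
  exists2 E, bfs_order e E & greedy_from e [::] set0 E [ffun => 0] psi.

(* A member that is a single vertex contains no edge, so that the algorithm
   never colors it; being free of collisions, it may take any color.  *)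
Definition with_edge : {set I} := [set r | arcs (R r) != set0].

End Colorings.

(* Main.v *)
(** The coloring built by GREEDY-COL is kept proper, with colors forming an
    initial segment {1, ..., m}, and with 2 m <= 5 k, where k is the optimum.
    Since the explored edges grow like a subtree, a colored member colliding
    with a member of Q_i contains {u, v} or, if this edge is of type 4, both of
    them contain {u, x}; in the first case first-fit needs no more colors than
    the load of {u, v}, which is at most 2 k.

    For an edge of type 4 the bound already holds for PROCESS-EDGE-2 alone.  Let
    X and Y be the colored members through {u, x} but not {u, v}, resp. through
    {u, v}, and let Z be the new members through {u, x}.  At most
    |X u Z| - |M| + |Y'| colors are needed, where Y' are the members of Y whose
    color does not occur in X.  As each of X u Y, Y u Z, X u Z lies on an edge at
    u, a class of an optimal coloring has at most two members in X u Y u Z, or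
    else one in each of X, Y and Z; thus |X| + |Y| + |Z| <= 2 k + t, with t <= k
    classes meeting both X and Z.  The member of X in such a class shares its
    color with a member of Y, or with another member of X, or with neither, and
    in the last case it is not adjacent in B_2 to the member of Z in the class.
    Hence |M| + |Y \ Y'| >= t / 2. *)

From Stdlib Require Import Classical.
Require Import Defs.
From mathcomp Require Import all_boot all_order all_algebra zify.
Import Order.TTheory GRing.Theory Num.Theory.
Set Implicit Arguments.
Unset Strict Implicit.
Unset Printing Implicit Defensive.

(** * Bridges of a tree *)

Section Bridges.
Variables (V : finType) (e : rel V).
Hypotheses (sym_e : symmetric e) (irr_e : irreflexive e).
Hypothesis acyclic_e : forall c : seq V, 2 < size c -> ~ ucycle e c.

Definition cut (a b : V) : rel V :=
  fun x y => e x y && ~~ ((x == a) && (y == b) || (x == b) && (y == a)).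

Lemma cut_sym a b : symmetric (cut a b).
Proof.
by move=> x y; rewrite /cut sym_e orbC andbC [(x == a) && _]andbC
  [(x == b) && _]andbC andbC.
Qed.

Lemma connect_cut_sym a b x y : connect (cut a b) x y = connect (cut a b) y x.
Proof. exact: (sym_connect_sym (cut_sym a b)). Qed.

(** A simple path from [a] to [b] avoiding the edge has at least two edges, so the edge closes it to
    a cycle of length at least 3. *)
Lemma cut_disconnects a b : e a b -> ~~ connect (cut a b) a b.
Proof.
move=> eab; apply/negP=> /connectP[p0 p0P]; case/shortenP: p0P => p pP up _ lp.
case: p pP up lp => [|y [|z p]] pP up lp.
- by move: eab; rewrite lp irr_e.
- by move: pP; rewrite /= lp /cut /= !eqxx /= andbF.
apply: (@acyclic_e [:: a, y, z & p]) => //; apply/andP; split=> //.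
rewrite /cycle rcons_path -lp sym_e eab andbT.
by apply: sub_path pP => x w /andP[].
Qed.

(** The step at which a walk leaves the component of [a] in the cut graph is an edge of [e] missing
    from [cut a b], hence the cut edge itself. *)
Lemma crossing (g : rel V) a b x y :
  subrel g e -> connect g x y ->
  connect (cut a b) a x -> ~~ connect (cut a b) a y -> g a b || g b a.
Proof.
move=> sge /connectP[p pP ->]; elim: p x pP => [|z p IH] x /=.
  by move=> _ ->.
case/andP=> gxz pP cx cy; case cz: (connect (cut a b) a z).
  exact: IH pP cz cy.
have: ~~ cut a b x z.
  apply: contraFN cz => cxz; exact: connect_trans cx (connect1 cxz).
rewrite /cut (sge _ _ gxz) negbK.
by case/orP=> /andP[/eqP <- /eqP <-]; rewrite gxz ?orbT.
Qed.

(** A simple path never returns to [u], so after its first edge it cannot use that edge again. *)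
Lemma first_step (g : rel V) u a :
  subrel g e -> connect g u a -> u != a ->
  exists2 y, g u y & connect (cut u y) y a.
Proof.
move=> sge /connectP[p0 p0P]; case/shortenP: p0P => p pP up _ lp.
case: p pP up lp => [|y p] pP up lp; first by rewrite lp eqxx.
move=> _; move: pP => /= /andP[guy pP]; exists y => //.
apply/connectP; exists p => //.
apply: (@sub_in_path _ (predC1 u) _ _ _ _ _ _ pP) => [x z|].
  rewrite !inE => xu zu gxz; rewrite /cut (sge _ _ gxz).
  by rewrite (negPf xu) (negPf zu) andbF.
move: up => /= /andP[uyp _]; rewrite -[_ && _]/(all (predC1 u) (y :: p)).
by apply/allP=> z zp /=; apply: contraNneq uyp => <-.
Qed.

(* The first edge {u, y} of the g-path from u to a separates a from d, since the
   h-path from u to d avoids it; hence g' must traverse it. *)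
Lemma collision_at (h g g' : rel V) u a d :
  subrel h e -> symmetric h -> subrel g e -> subrel g' e -> symmetric g' ->
  (forall x y, g x y -> ~~ h x y) ->
  connect g u a -> u != a -> connect h u d -> connect g' a d ->
  exists2 y, g u y & g' u y.
Proof.
move=> she sym_h sge sge' sym_g' gh cga ua chd cg'.
have [y guy cya] := first_step sge cga ua.
have eNc : ~~ connect (cut u y) u y by apply/cut_disconnects/sge.
have cud : connect (cut u y) u d.
  apply: connect_sub chd => x z hxz; apply: connect1.
  rewrite /cut she //; apply: contraL (hxz).
  case/orP=> /andP[/eqP-> /eqP->]; last rewrite sym_h; exact: gh.
exists y => //.
have : g' u y || g' y u; last by rewrite [g' y u]sym_g' orbb.
apply: (@crossing g' u y d a) => //.
  by rewrite (sym_connect_sym sym_g').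
apply: contra eNc => cua; apply: connect_trans cua _.
by rewrite connect_cut_sym.
Qed.

(** If [h] missed the edge, it would lie in the cut graph and could not join the two ends. *)
Lemma connected_edge (h : rel V) a b :
  subrel h e -> symmetric h -> e a b -> connect h a b -> h a b.
Proof.
move=> she sym_h eab; apply: contraTT => nhab.
apply: contra (cut_disconnects eab); apply: connect_sub => x y hxy.
apply: connect1; rewrite /cut she //; apply: contraL (hxy).
by case/orP=> /andP[/eqP-> /eqP->] //; rewrite sym_h.
Qed.

End Bridges.

(** * Breadth-first search *)

Section Orders.
Variables (V : finType) (e : rel V).
Implicit Types (D : {set V}) (E : seq (V * V)).

(** The form in which the search enters the main argument: every new edge hangs a fresh vertex onto
    the discovered ones, so the explored edges form a growing subtree. *)
Fixpoint grows D E : bool :=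
  if E is (u, v) :: E' then [&& u \in D, v \notin D, e u v & grows (v |: D) E']
  else true.

Lemma grows_cat D E1 E2 :
  grows D (E1 ++ E2) = grows D E1 && grows (D :|: [set v in unzip2 E1]) E2.
Proof.
elim: E1 D => [|[u v] E1 IH] D /=.
  by congr grows; apply/setP=> z; rewrite !inE orbF.
rewrite IH -!andbA; do 4!congr (_ && _); congr grows.
by apply/setP=> z; rewrite !inE orbCA orbA.
Qed.

Lemma grows_new D E a b : grows D E -> (a, b) \in E -> b \notin D.
Proof.
elim: E D => // [[u v] E] IH D /= /and4P[_ vD _ gE].
rewrite inE => /orP[/eqP[_ ->] //|/(IH _ gE)].
by rewrite inE negb_or => /andP[].
Qed.

Lemma bfs_grows q D E : bfs_from e q D E -> {subset q <= D} -> grows D E.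
Proof.
elim=> [D' //|u q' D' s E' us sP _ IH] qD; rewrite grows_cat.
have uD : u \in D' by apply: qD; rewrite inE eqxx.
have sE : unzip2 [seq (u, v) | v <- s] = s by rewrite /unzip2 -map_comp map_id.
apply/andP; split; last first.
  rewrite sE; apply: IH => z; rewrite mem_cat !inE => /orP[zq|->]; last first.
    by rewrite orbT.
  by rewrite qD // inE zq orbT.
(* One visit discovers all of [s] at once; it is replayed edge by edge, and [uniq s] keeps the later
   siblings undiscovered. *)
have {sP} : {in s, forall v, (v \notin D') && e u v}.
  by move=> v; rewrite sP !inE.
move: D' uD us {IH qD sE} => D' uD us sP.
elim: s us D' uD sP => //= v s IH /andP[vs us] D' uD sP.
have /andP[-> ->] := sP v (mem_head _ _); rewrite uD /=.
apply: IH => // [|z zs]; first by rewrite inE uD orbT.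
have /andP[zD ->] := sP z (mem_behead (s := v :: s) zs).
by rewrite !inE (negPf zD) orbF andbT; apply: contraNneq vs => <-.
Qed.

(** The invariant is that a discovered vertex outside the queue has only discovered neighbors; at
    the end the queue is empty. *)
Lemma bfs_closed q D E : bfs_from e q D E -> {subset q <= D} ->
  (forall z y, z \in D -> z \notin q -> e z y -> y \in D) ->
  forall z y, z \in D :|: [set v in unzip2 E] -> e z y ->
    y \in D :|: [set v in unzip2 E].
Proof.
elim=> [D' _ clD z y|u q' D' s E' us sP _ IH qD clD z y].
  rewrite !inE !orbF => zD; exact: clD.
have sE : unzip2 [seq (u, v) | v <- s] = s by rewrite /unzip2 -map_comp map_id.
have -> : D' :|: [set v in unzip2 ([seq (u, v) | v <- s] ++ E')] =
    (D' :|: [set v in s]) :|: [set v in unzip2 E'].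
  by apply/setP=> x; rewrite !inE /unzip2 map_cat -/unzip2 sE mem_cat orbA.
apply: IH => {z y} [z|z y].
  rewrite mem_cat !inE => /orP[zq|->]; last by rewrite orbT.
  by rewrite qD // inE zq orbT.
rewrite mem_cat !inE negb_or => zD /andP[zq zs] ezy.
rewrite (negPf zs) orbF in zD; rewrite sP !inE.
case: (eqVneq z u) => [zu|zu].
  by rewrite -zu ezy andbT orbN.
by rewrite (clD z y) // inE negb_or zu zq.
Qed.

(** The queue length plus the number of undiscovered vertices decreases: the vertices of [s] move
    from the second term to the first, and [u] leaves the queue. *)
Lemma bfs_exists q D : {subset q <= D} -> exists E, bfs_from e q D E.
Proof.
have [n] := ubnP (size q + #|~: D|); elim: n q D => // n IH [|u q] D le_n qD.
  by exists [::]; constructor.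
pose s := enum (neighbors e u :\: D).
have sP : s =i neighbors e u :\: D by move=> x; rewrite mem_enum.
have us : uniq s by apply: enum_uniq.
have [||E HE] := IH (q ++ s) (D :|: [set v in s]).
- have cs : #|[set v in s]| = size s by rewrite cardsE; apply/card_uniqP.
  suff: size s + #|~: (D :|: [set v in s])| <= #|~: D|.
    by move: le_n; rewrite size_cat /=; lia.
  rewrite -cs -cardsUI.
  have -> : [set v in s] :&: ~: (D :|: [set v in s]) = set0.
    by apply/setP=> x; rewrite !inE negb_or andbCA andbN andbF.
  rewrite cards0 addn0; apply/subset_leq_card/subsetP=> x.
  by rewrite !inE sP !inE; case: (x \in D).
- move=> z; rewrite mem_cat !inE => /orP[zq|->]; last by rewrite orbT.
  by rewrite qD // inE zq orbT.
by exists ([seq (u, v) | v <- s] ++ E); apply: bfs_visit HE.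
Qed.

Lemma listed_sym E : symmetric (listed E).
Proof. by move=> x y; rewrite /listed orbC. Qed.

Lemma grows_edges D E a b : symmetric e -> grows D E -> listed E a b -> e a b.
Proof.
move=> sym_e; elim: E D => // [[u v] E] IH D /= /and4P[_ _ euv gE].
rewrite /listed !inE orbACA => /orP[|]; last exact: IH gE.
by case/orP=> /eqP[-> ->] //; rewrite sym_e.
Qed.

Lemma connect_grow (h h' : rel V) D u v :
  {in D &, forall x y, connect h x y} -> subrel h h' -> symmetric h' ->
  u \in D -> h' u v -> {in v |: D &, forall x y, connect h' x y}.
Proof.
move=> Dh sh sym_h' uD huv x y.
have cu z : z \in v |: D -> connect h' u z.
  rewrite !inE => /orP[/eqP->|zD]; first exact: connect1.
  by apply: connect_sub (Dh _ _ uD zD) => p q /sh /connect1.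
move=> /cu xD /cu yD; apply: connect_trans yD.
by rewrite (sym_connect_sym sym_h').
Qed.

Lemma listed_cat E1 E2 a b :
  listed (E1 ++ E2) a b = listed E1 a b || listed E2 a b.
Proof. by rewrite /listed !mem_cat orbACA. Qed.

Lemma grows_connect pre D E :
  {in D &, forall x y, connect (listed pre) x y} -> grows D E ->
  {in D :|: [set v in unzip2 E] &, forall x y, connect (listed (pre ++ E)) x y}.
Proof.
elim: E D pre => [|[u v] E IH] D pre Dh /=.
  move=> _ x y; rewrite cats0 !inE !orbF; exact: Dh.
case/and4P=> uD vD _ gE x y.
have -> : D :|: [set z in v :: unzip2 E] = (v |: D) :|: [set z in unzip2 E].
  by apply/setP=> z; rewrite !inE orbA (orbC (z \in D)) -orbA.
rewrite -cat_rcons; apply: IH gE x y.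
apply: connect_grow Dh _ _ uD _; last 1 first.
- by rewrite /listed mem_rcons inE eqxx.
- by move=> x y; rewrite -cats1 listed_cat => ->.
exact: listed_sym.
Qed.

(** All vertices are discovered, so the listed edges form a connected spanning subgraph of the tree;
    every edge being a bridge, none can be missing. *)
Lemma bfs_order_listed E : is_tree [set: V] e -> bfs_order e E ->
  (exists root, grows [set root] E) /\ forall a b, e a b -> listed E a b.
Proof.
case=> _ [sym_e irr_e] _ conn_e acyc [root HE].
have sub1 : {subset [:: root] <= [set root]} by move=> z; rewrite !inE.
have gE := bfs_grows HE sub1.
split; first by exists root.
have clE : forall z y, z \in [set root] :|: [set v in unzip2 E] -> e z y ->
    y \in [set root] :|: [set v in unzip2 E].
  by apply: (bfs_closed HE sub1) => z y /set1P->; rewrite mem_head.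
set S := _ :|: _ in clE.
have allS z : z \in S.
  have /connectP[p + ->] : connect e root z by apply: conn_e; rewrite inE.
  have: root \in S by rewrite !inE eqxx.
  elim: p (root) => [|y p IH] x xS //= /andP[exy]; apply: IH.
  exact: clE exy.
move=> a b eab.
apply: (@connected_edge V e) => //.
- by move=> x y; apply: grows_edges gE.
- exact: listed_sym.
have h0 : {in [set root] &, forall x y, connect (listed [::]) x y}.
  by move=> x y /set1P-> /set1P->.
by apply: (@grows_connect [::] _ _ h0 gE); apply: allS.
Qed.
End Orders.

(** * Counting against an optimal coloring *)

Section Counting.
Variables (V I : finType) (R : I -> digraph V).
Implicit Types (P Q W A X Y : {set I}) (r s t : I) (M : {set {set I}}).
Implicit Types (psi : {ffun I -> nat}).

Lemma underlying_sym (G : digraph V) : symmetric (underlying G).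
Proof. by move=> x y; rewrite /underlying orbC. Qed.

Lemma collide_sym : symmetric (collide R).
Proof. by move=> r s; rewrite /collide setIC. Qed.

Lemma collideP r s :
  reflect (exists2 a, a \in arcs (R r) & a \in arcs (R s)) (collide R r s).
Proof.
rewrite /collide; apply: (iffP (set0Pn _)) => [[a /setIP[]]|[a ar as_]]; first by exists a.
by exists a; apply/setIP.
Qed.

(** An edge has two directions, so two of the three members use it in the same one. *)
Lemma three_on_edge a b r s t :
  underlying (R r) a b -> underlying (R s) a b -> underlying (R t) a b ->
  [|| collide R r s, collide R r t | collide R s t].
Proof.
have co p q c : c \in arcs (R p) -> c \in arcs (R q) -> collide R p q.
  by move=> cp cq; apply/collideP; exists c.
by move=> /orP[]hr /orP[]hs /orP[]ht; apply/or3P;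
  do [exact: Or31 (co _ _ _ hr hs) | exact: Or32 (co _ _ _ hr ht)
     | exact: Or33 (co _ _ _ hs ht)].
Qed.

Lemma independent_on_edge a b A :
  {in A, forall r, underlying (R r) a b} ->
  {in A &, forall r s, r != s -> ~~ collide R r s} -> #|A| <= 2.
Proof.
move=> Aab indA; rewrite leqNgt; apply/card_gt2P=> -[r [s [t [[rA sA tA] [rs st tr]]]]].
have := three_on_edge (Aab r rA) (Aab s sA) (Aab t tA).
rewrite (negPf (indA r s rA sA rs)) (negPf (indA s t sA tA st)) orbF /=.
by rewrite collide_sym (negPf (indA t r tA rA tr)).
Qed.

Lemma card_fibers k (f : I -> 'I_k) A :
  #|A| = \sum_(j < k) #|[set i in A | f i == j]|.
Proof.
rewrite -sum1_card (partition_big f xpredT) //=; apply: eq_bigr => j _.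
by rewrite -sum1_card; apply: eq_bigl => i; rewrite inE.
Qed.

(** The two members of a pair of [M] share a color, so each pair saves one color on [W]. *)
Lemma matched_colors psi M W Y c :
  trivIset M -> {in M, forall A, (A \subset W) && (#|A| == 2)} ->
  {in M, forall A, {in A &, forall r s, psi r = psi s}} ->
  (forall d, 0 < d <= c -> exists2 t, t \in W :|: Y & psi t = d) ->
  c + #|M| <= #|W| + #|Y|.
Proof.
move=> trM M2 mono hc.
pose col A := if [pick r in A] is Some r then psi r else 0.
(* One entry for each unmatched member of [W], each pair and each member of [Y]: the length is |W| -
   2|M| + |M| + |Y|, and all of 1, ..., c occur. *)
pose l := [seq psi r | r in W :\: cover M] ++ [seq col A | A in M]
          ++ [seq psi r | r in Y].
have : size (iota 1 c) <= size l.
  apply: uniq_leq_size (iota_uniq _ _) _ => d; rewrite mem_iota add1n ltnS.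
  move=> /hc[t tWY <-]; rewrite !mem_cat; apply/or3P.
  have [tM|tM] := boolP (t \in cover M).
    apply: Or32; have /bigcupP[A AM tA] := tM.
    apply/imageP; exists A => //; rewrite /col.
    by case: pickP => [r rA|/(_ t)]; [apply: mono tA rA | rewrite tA].
  case/setUP: tWY => tW; [apply: Or31|apply: Or33]; apply/imageP.
    by exists t => //; rewrite !inE tM.
  by exists t.
have cM : #|cover M| = #|M| * 2.
  rewrite -(eqP trM) -sum_nat_const; apply: eq_bigr => A /M2 /andP[_ /eqP->] //.
have sMW : cover M \subset W.
  by apply/bigcupsP=> A /M2 /andP[].
have sz (A : {set I}) : size [seq psi i | i in A] = #|A| by apply: size_image.
have szM : size [seq col A | A in M] = #|M| by apply: size_image.
rewrite size_iota /l !size_cat !sz szM.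
have := cardsID (cover M) W; rewrite (setIidPr sMW) cM.
lia.
Qed.

(** * Loads and color classes of an optimal coloring [f] *)

Section Optimal.
Variables (k : nat) (f : I -> 'I_k).
Hypothesis f_proper : forall r s, r != s -> f r = f s -> ~~ collide R r s.

Lemma fiber_le2 a b A j : {in A, forall r, underlying (R r) a b} ->
  #|[set i in A | f i == j]| <= 2.
Proof.
move=> Aab; apply: (independent_on_edge (a := a) (b := b)) => [r|r s].
  by rewrite inE => /andP[/Aab].
rewrite !inE => /andP[_ /eqP fr] /andP[_ /eqP fs] rs.
by apply: f_proper => //; rewrite fr fs.
Qed.

Lemma load_bound a b A : {in A, forall r, underlying (R r) a b} ->
  #|A| <= 2 * k.
Proof.
move=> Aab; rewrite (card_fibers f) mulnC -[X in X * _]card_ord -sum_nat_const.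
by apply: leq_sum => j _; apply: fiber_le2 Aab.
Qed.

(** * The size of a maximum matching at an edge of type 4 *)

Section MatchingBound.
Variables (P Q X Z Y : {set I}) (psi : {ffun I -> nat}) (u v w x : V).
Hypotheses (XP : X \subset P) (YP : Y \subset P) (ZQ : Z \subset Q).
Hypotheses (PQ : [disjoint P & Q]) (XY : [disjoint X & Y]).
Hypotheses (Xw : {in X :|: Y, forall r, underlying (R r) u w})
  (Yv : {in Y :|: Z, forall r, underlying (R r) u v})
  (Xx : {in X :|: Z, forall r, underlying (R r) u x}).
Hypothesis near : forall r t, r \in Z -> t \in P -> collide R t r -> t \in X :|: Y.
Hypothesis psi_proper : {in P &, forall r s, r != s -> psi r = psi s -> ~~ collide R r s}.

(* T stands for the optimal classes meeting X and Z, through their members in X;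
   TY, TX and T0 split it by where the color of such a member recurs. *)
Let T := [set s in X | [exists r in Z, f r == f s]].
Let TY := [set s in T | [exists y in Y, psi y == psi s]].
Let TX := [set s in T | [exists y in X, (y != s) && (psi y == psi s)]].
Let T0 := T :\: (TY :|: TX).
Let Y1 := [set y in Y | [exists s in X, psi s == psi y]].
Let psi_class s := [set r in X | psi r == psi s].
Let f_class s := [set r in X :|: Z | f r == f s].
(** Two families of candidate pairs for a matching: two members of [X] with the same current color,
    and a member of [T0] with the member of [Z] in its optimal class. *)
Let MX := [set psi_class s | s in X & #|psi_class s| == 2].
Let M0 := f_class @: T0.

Let XZ : [disjoint X & Z].
Proof. exact: disjointWl XP (disjointWr ZQ PQ). Qed.

Let inXZ r : r \in X -> r \in Z -> False.
Proof. by move=> rX rZ; have := disjointFr XZ rX; rewrite rZ. Qed.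

(** In each optimal class any two of [X], [Y], [Z] together have at most two members. Hence the
    three have at most two, unless both [X] and [Z] are met; then they have at most three, and [T]
    supplies the extra one. *)
Lemma triple_count : #|X| + #|Z| + #|Y| <= 2 * k + #|T|.
Proof.
rewrite !(card_fibers f) -!big_split /=.
rewrite [2 * k]mulnC -[X in X * _]card_ord -sum_nat_const -big_split /=.
apply: leq_sum => j _.
have cU (A B : {set I}) : [disjoint A & B] ->
    #|[set i in A | f i == j]| + #|[set i in B | f i == j]| =
    #|[set i in A :|: B | f i == j]|.
  move=> dAB; rewrite -cardsUI -[RHS]addn0; congr (_ + _).
    by apply: eq_card => i; rewrite !inE andb_orl.
  apply/eqP; rewrite cards_eq0; apply/eqP/setP=> i; rewrite !inE.
  by case iA: (i \in A); rewrite //= (disjointFr dAB iA) andbF.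
have YZ : [disjoint Y & Z] by apply: disjointWl YP (disjointWr ZQ PQ).
have := fiber_le2 j Xw; have := fiber_le2 j Yv; have := fiber_le2 j Xx.
rewrite -!cU //.
have: 0 < #|[set i in X | f i == j]| -> 0 < #|[set i in Z | f i == j]| ->
    0 < #|[set i in T | f i == j]|.
  case/card_gt0P=> s; rewrite inE => /andP[sX /eqP fs].
  case/card_gt0P=> r; rewrite inE => /andP[rZ /eqP fr].
  apply/card_gt0P; exists s; rewrite !inE sX fs eqxx andbT /=.
  by apply/existsP; exists r; rewrite rZ fr eqxx.
lia.
Qed.

(** [f] is injective on [T]: two members of one class in [X] and a third in [Z] would be three
    independent members on {u, x}. *)
Lemma card_T : #|T| <= k.
Proof.
rewrite -[leqRHS]card_ord -(card_in_imset (f := f) (D := mem T)).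
  exact: max_card.
move=> s t; rewrite !inE => /andP[sX /existsP[r /andP[rZ /eqP frs]]] /andP[tX _] fst.
apply/eqP; apply: contraT => st.
have nr p : p \in X -> p != r.
  by move=> pX; apply/eqP=> pr; apply: (@inXZ p); rewrite // pr.
have inU p : p \in X -> p \in X :|: Z by rewrite inE => ->.
have rU : r \in X :|: Z by rewrite inE rZ orbT.
have := three_on_edge (Xx (inU _ sX)) (Xx (inU _ tX)) (Xx rU).
rewrite (negPf (f_proper st fst)).
rewrite (negPf (f_proper (nr _ sX) (esym frs))).
by rewrite (negPf (f_proper (nr _ tX) _)) // -fst.
Qed.

Lemma psi_class_le2 s : #|psi_class s| <= 2.
Proof.
apply: (independent_on_edge (a := u) (b := w)) => [r|r t]; rewrite !inE.
  by case/andP=> rX _; apply: Xw; rewrite inE rX.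
case/andP=> rX /eqP rs /andP[tX /eqP ts] rt.
by apply: psi_proper; rewrite ?(subsetP XP) // rs ts.
Qed.

(** [psi] is injective on [TY], as two members of [X] and one of [Y] with a common color would be
    three independent members on {u, w}. Its values there are colors of [Y1]. *)
Lemma card_TY : #|TY| <= #|Y1|.
Proof.
have inj : {in TY &, injective psi}.
  move=> s t; rewrite !inE => /andP[/andP[sX _] /existsP[y /andP[yY /eqP ys]]].
  case/andP=> /andP[tX _] _ st; apply/eqP; apply: contraT => nst.
  have ny p : p \in X -> p != y.
    by move=> pX; apply/eqP=> py; have := disjointFr XY pX; rewrite py yY.
  have inU p : p \in X -> p \in X :|: Y by rewrite inE => ->.
  have yU : y \in X :|: Y by rewrite inE yY orbT.
  have Pp p : p \in X :|: Y -> p \in P.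
    by case/setUP; [apply: (subsetP XP)|apply: (subsetP YP)].
  have := three_on_edge (Xw (inU _ sX)) (Xw (inU _ tX)) (Xw yU).
  have [sP tP yP] := And3 (Pp _ (inU _ sX)) (Pp _ (inU _ tX)) (Pp _ yU).
  rewrite (negPf (psi_proper sP tP nst st)).
  rewrite (negPf (psi_proper sP yP (ny _ sX) (esym ys))).
  by rewrite (negPf (psi_proper tP yP (ny _ tX) (etrans (esym st) (esym ys)))).
have sz (A : {set I}) : size [seq psi i | i in A] = #|A| by apply: size_image.
rewrite -!sz.
apply: uniq_leq_size => [|d /imageP[s sT ->]].
  by rewrite map_inj_in_uniq ?enum_uniq // => s t; rewrite !mem_enum; apply: inj.
move: sT; rewrite !inE => /andP[/andP[sX _] /existsP[y /andP[yY /eqP ys]]].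
apply/imageP; exists y => //; rewrite inE yY.
by apply/existsP; exists s; rewrite sX ys /=.
Qed.

(** A class has at most two members on {u, x}, so [s] and its partner in [Z] exhaust it. *)
Lemma f_class_pair s : s \in T ->
  exists r, [/\ r \in Z, f r = f s & f_class s = [set s; r]].
Proof.
rewrite inE => /andP[sX /existsP[r /andP[rZ /eqP frs]]]; exists r; split=> //.
have nsr : s != r by apply/eqP=> sr; apply: (inXZ sX); rewrite sr.
apply/esym/eqP; rewrite eqEcard cards2 nsr /= (fiber_le2 _ Xx) andbT.
by apply/subsetP=> i /set2P[]->; rewrite !inE ?sX ?rZ ?frs ?eqxx ?orbT.
Qed.

Lemma unmated s t : s \in T0 -> t \in X :|: Y -> psi t = psi s -> t = s.
Proof.
rewrite !inE -andbA => /andP[+ /andP[sX sT]] tXY pts.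
rewrite sX sT /= => /norP[nY nX]; apply/eqP; apply: contraT => ts.
case/orP: tXY => tin.
  by case/negP: nX; apply/existsP; exists t; rewrite tin ts pts /=.
by case/negP: nY; apply/existsP; exists t; rewrite tin pts /=.
Qed.

Lemma T0T s : s \in T0 -> s \in T.
Proof. by case/setDP. Qed.

Lemma TsubX s : s \in T -> s \in X.
Proof. by rewrite inE => /andP[]. Qed.

(** Pairs in [MX] have equal current colors and pairs in [M0] equal optimal colors, so neither
    collide. A pair in [M0] is not blocked either, since the color of its member of [X] recurs
    nowhere in [X :|: Y]. *)
Lemma mate_matching : matching (compl_adj R P Q psi (X :|: Z)) (MX :|: M0).
Proof.
have PnQ r : r \in P -> r \in Q = false by move=> rP; apply: disjointFr PQ rP.
(* A common member of the two kinds of pairs would lie in [T0] and yet share its color with another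
   member of [X]. *)
have mixed p s i : #|psi_class p| == 2 -> s \in T0 ->
    i \in psi_class p -> i \in f_class s -> False.
  move=> p2 sT0 ip iq; have [r [rZ _ Es]] := f_class_pair (T0T sT0).
  have iX : i \in X by move: ip; rewrite inE => /andP[].
  have {iq}Eis : i = s.
    by move: iq; rewrite Es => /set2P[//|ir]; case: (inXZ iX); rewrite ir.
  move: ip p2; rewrite Eis inE => /andP[_ /eqP psp] /eqP p2.
  have: 1 < #|psi_class p| by rewrite p2.
  case/card_gt1P=> a [b [ap bp]] /eqP; case.
  have cl c : c \in psi_class p -> c = s.
    rewrite inE => /andP[cX /eqP cp]; apply: (unmated sT0); last by rewrite cp.
    by rewrite inE cX.
  by rewrite (cl a ap) (cl b bp).
split.
  apply/trivIsetP=> A B AM BM; apply: contraR => /pred0Pn[i /andP[/= iA iB]].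
  apply/eqP; case/setUP: AM iA => /imsetP[s sP ->]; case/setUP: BM iB => /imsetP[t tP ->].
  - rewrite !inE => /andP[_ /eqP it] /andP[_ /eqP is_].
    by apply/setP=> j; rewrite !inE -is_ -it.
  - move=> it is_; exfalso; move: sP; rewrite inE => /andP[_ s2].
    exact: mixed s2 tP is_ it.
  - move=> it is_; exfalso; move: tP; rewrite inE => /andP[_ t2].
    exact: mixed t2 sP it is_.
  rewrite !inE => /andP[_ /eqP it] /andP[_ /eqP is_].
  by apply/setP=> j; rewrite !inE -is_ -it.
move=> A /setUP[] /imsetP[s sP ->].
  move: sP; rewrite inE => /andP[sX /cards2P[a [b [ab E]]]]; exists a, b; split=> //.
  have: a \in psi_class s by rewrite E set21.
  have: b \in psi_class s by rewrite E set22.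
  rewrite !inE => /andP[bX /eqP bs] /andP[aX /eqP as_].
  have [aP bP] := (subsetP XP _ aX, subsetP XP _ bX).
  rewrite /compl_adj /conflict /blocked !inE aX bX ab !PnQ // as_ bs eqxx aP bP.
  by rewrite !orbF /=; apply: psi_proper; rewrite ?as_ ?bs.
have [r [rZ frs E]] := f_class_pair (T0T sP); exists s, r; split=> //.
have sX := TsubX (T0T sP).
have nsr : s != r by apply/eqP=> sr; apply: (inXZ sX); rewrite sr.
have rP : r \in P = false.
  by apply: disjointFl PQ _; apply: (subsetP ZQ).
have ncsr : ~~ collide R s r by apply: f_proper nsr _.
rewrite /compl_adj /conflict /blocked !inE sX rZ nsr rP (PnQ s) ?(subsetP XP) //=.
rewrite orbT (negPf ncsr) (subsetP ZQ) //=.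
apply/existsP=> -[t /andP[tP /andP[/eqP pts ctr]]].
(* A blocking [t] collides with [r], so it lies in [X :|: Y] and has the color of [s]. *)
have ts : t = s by apply: (unmated sP) => //; apply: near ctr.
by rewrite -ts ctr in ncsr.
Qed.

(** The pairs of [MX] cover [TX], two members each, and [M0] has one pair for each member of
    [T0]. *)
Lemma card_mates : 2 * #|MX :|: M0| >= #|TX| + 2 * #|T0|.
Proof.
have [trM _] := mate_matching.
have trX : trivIset MX by apply: trivIsetS trM; apply: subsetUl.
have dis : MX :&: M0 = set0.
  apply/setP=> A; rewrite inE in_set0; apply/negP=> /andP[/imsetP[p _ ->]].
  case/imsetP=> s /T0T /f_class_pair[r [rZ _ ->]] /setP /(_ r).
  rewrite set22 inE => /andP[rX _]; exact: inXZ rX rZ.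
have c0 : #|M0| = #|T0|.
  rewrite card_in_imset // => s t /T0T sT /T0T tT E.
  have [r [rZ _ Es]] := f_class_pair sT.
  have: t \in f_class s by rewrite E !inE TsubX // eqxx.
  rewrite Es => /set2P[//|tr]; case: (inXZ (TsubX tT)); rewrite tr //.
have cX : #|TX| <= #|cover MX|.
  apply/subset_leq_card/subsetP=> s; rewrite inE => /andP[/TsubX sX].
  case/existsP=> y /and3P[yX ys pys]; apply/bigcupP; exists (psi_class s).
    apply/imsetP; exists s => //; rewrite inE sX eqn_leq psi_class_le2 /=.
    by apply/card_gt1P; exists s, y; rewrite !inE sX yX pys eq_sym ys eqxx.
  by rewrite inE sX eqxx.
have cM : #|cover MX| = #|MX| * 2.
  rewrite -(eqP trX) -sum_nat_const; apply: eq_bigr => A /imsetP[s + ->].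
  by rewrite inE => /andP[_ /eqP].
have := cardsUI MX M0; rewrite dis cards0; lia.
Qed.

(** By [triple_count] the left side is at most 4k + 2|T| - 2|Y1|. One |T| is at most k; the other is
    at most |TY| + |TX| + |T0|, which is absorbed by |TY| <= |Y1| and |TX| + 2|T0| <= 2|M|. *)
Lemma matching_bound M :
  maximum_matching (compl_adj R P Q psi (X :|: Z)) M ->
  2 * (#|X :|: Z| + #|Y :\: Y1|) <= 5 * k + 2 * #|M|.
Proof.
case=> _ /(_ _ mate_matching) leM0.
have leM : #|MX :|: M0| <= #|M| by [].
have := card_mates; have := triple_count; have := card_TY; have := card_T.
have sTY : TY \subset T by apply/subsetP=> s; rewrite inE => /andP[].
have sTX : TX \subset T by apply/subsetP=> s; rewrite inE => /andP[].
have := subset_leq_card sTX.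
have := cardsID (TY :|: TX) T; rewrite -/T0.
have := cardsUI TY TX.
have -> : T :&: (TY :|: TX) = TY :|: TX.
  by apply/setIidPr; rewrite subUset sTY.
have := cardsUI X Z; rewrite (disjoint_setI0 XZ) cards0.
have := cardsID Y1 Y.
have -> : Y :&: Y1 = Y1 by apply/setIidPr/subsetP=> s; rewrite inE => /andP[].
lia.
Qed.

End MatchingBound.
End Optimal.
End Counting.

(** * Invariants of the coloring loop *)

Section Dynamics.
Variables (V I : finType) (R : I -> digraph V).
Implicit Types (P Q W A : {set I}) (r s t : I) (M : {set {set I}}).
Implicit Types (psi chi : {ffun I -> nat}).

(** The value 0 means uncolored, so colliding members may agree only there. *)
Definition proper_coloring psi :=
  forall r s, r != s -> collide R r s -> psi r = psi s -> psi r = 0.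

(** Makes the largest color a lower bound for the number of colors, which is how two colorings are
    compared by their largest colors. *)
Definition contiguous psi :=
  forall r d, 0 < d <= psi r -> exists t, psi t = d.

Lemma ncolors_le psi A m :
  {in A, forall r, 0 < psi r <= m} -> ncolors psi A <= m.
Proof.
move=> Am; rewrite -(size_iota 1 m).
apply: uniq_leq_size (undup_uniq _) _ => d; rewrite mem_undup => /imageP[r rA ->].
by rewrite mem_iota add1n ltnS; apply: Am.
Qed.

Lemma contiguous_le psi A r :
  contiguous psi -> (forall t, psi t != 0 -> t \in A) -> psi r <= ncolors psi A.
Proof.
move=> cpsi supp; rewrite -(size_iota 1 (psi r)).
apply: uniq_leq_size (iota_uniq _ _) _ => d; rewrite mem_iota add1n ltnS.
move=> dr; have [t td] := cpsi r d dr; rewrite mem_undup; apply/imageP.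
by exists t => //; apply: supp; rewrite td -lt0n; case/andP: dr.
Qed.

Lemma first_free_exists psi A : exists c, first_free R psi A c.
Proof.
have ex : exists c, free_color R psi A c.
  exists (\max_t psi t).+1; rewrite /free_color /=.
  apply/forall_inP=> r _; apply/forallP=> t; apply/implyP=> _.
  by rewrite neq_ltn ltnS leq_bigmax.
by case: (ex_minnP ex) => c cP min; exists c; split.
Qed.

Lemma first_free_below psi A c d : first_free R psi A c -> 0 < d < c ->
  exists r t, [/\ r \in A, collide R t r & psi t = d].
Proof.
case=> _ min /andP[d0 dc].
have: ~~ free_color R psi A d.
  by apply/negP=> /min; rewrite leqNgt dc.
rewrite /free_color d0 /= negb_forall => /existsP[r].
rewrite negb_imply negb_forall => /andP[rA /existsP[t]].
by rewrite negb_imply negbK => /andP[tr /eqP td]; exists r, t.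
Qed.

Lemma recolorE psi A c r : recolor psi A c r = if r \in A then c else psi r.
Proof. by rewrite ffunE. Qed.

(** Both kinds of loop step become one: an unmatched [r] is treated as the degenerate pair
    [[set r; r]]. *)
Lemma loop_invariant M Q psi psi' (J : {ffun I -> nat} -> Prop) :
  color_loop R M Q psi psi' ->
  (forall chi r s c, J chi -> r \in Q -> chi r = 0 ->
     (s = r /\ r \notin cover M) \/ [set r; s] \in M ->
     first_free R chi [set r; s] c -> J (recolor chi [set r; s] c)) ->
  J psi -> J psi' /\ {in Q, forall r, psi' r != 0}.
Proof.
move=> + step; elim=> {psi psi'} [//|psi psi' r s c rQ r0 rsM ff _ IH Jpsi|].
  by apply: IH; apply: step => //; right.
move=> psi psi' r c rQ r0 rM ff _ IH Jpsi; apply: IH; rewrite -[[set r]]setUid.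
by apply: step => //; [left | rewrite setUid].
Qed.

Definition extends psi Q chi :=
  (forall r, psi r != 0 -> chi r = psi r) /\
  (forall r, chi r != 0 -> psi r != 0 \/ r \in Q).

Definition monochromatic M psi :=
  forall r s, [set r; s] \in M -> psi r = psi s.

Definition good psi Q M chi :=
  [/\ extends psi Q chi, proper_coloring chi, contiguous chi & monochromatic M chi].

(** * Preservation of the invariant by one coloring step *)

Section Loop.
Variables (M : {set {set I}}) (Q : {set I}) (psi : {ffun I -> nat}).
Hypothesis trivM : trivIset M.
Hypothesis indep : forall r s, [set r; s] \in M -> (r != s) && ~~ collide R r s.
Hypothesis uncolored : forall r s, [set r; s] \in M -> psi s = 0 -> s \in Q.

(** Matched partners always carry equal values, so the partner of an uncolored member is uncolored
    and no color is overwritten. Contiguity survives because every color below the chosen one is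
    already in use. *)
Lemma good_recolor chi r s c : good psi Q M chi -> r \in Q -> chi r = 0 ->
  (s = r /\ r \notin cover M) \/ [set r; s] \in M ->
  first_free R chi [set r; s] c ->
  [/\ s \in Q, chi s = 0 & good psi Q M (recolor chi [set r; s] c)].
Proof.
move=> [[ext1 ext2] prop cont mono] rQ r0 rs ff.
have s0 : chi s = 0 by case: rs => [[->]|/mono <-].
have sQ : s \in Q.
  case: rs => [[-> _]//|/uncolored]; apply.
  by apply/eqP; apply: contraT => s1; have := ext1 s s1; rewrite s0 => E; rewrite -E in s1.
set A := [set r; s] in ff *.
have A0 t : t \in A -> chi t = 0 by case/set2P=> ->.
have AQ t : t \in A -> t \in Q by case/set2P=> ->.
have [/andP[c0 fc] _] := ff.
have nA t : chi t != 0 -> t \notin A by apply: contra => /A0 ->.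
have free p q : p \in A -> collide R q p -> chi q != c.
  move=> pA; have /forallP/(_ q)/implyP := forall_inP fc p pA; exact.
split=> //; split.
- split=> t; rewrite recolorE.
    move=> t0; rewrite ifN; first exact: ext1.
    by apply: nA; rewrite ext1.
  by case: ifP => [/AQ tQ _|_ /ext2 //]; right.
- move=> p q pq cpq; rewrite !recolorE; case: ifP => pA; case: ifP => qA.
  + move: rs => [[sr _]|/indep /andP[_ nc]].
      by move: pA qA pq; rewrite /A sr setUid => /set1P-> /set1P->; rewrite eqxx.
    case/negP: nc; move: pA qA pq cpq => /set2P[]-> /set2P[]->; rewrite ?eqxx //.
    by rewrite collide_sym.
  + by move=> /esym/eqP cq; move: cpq; rewrite collide_sym => /(free _ _ pA); rewrite cq.
  + by move=> /eqP cp; have := free _ _ qA cpq; rewrite cp.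
  by apply: prop.
- have keep t d : 0 < d -> chi t = d -> recolor chi A c t = d.
    by move=> d0 td; rewrite recolorE ifN // nA // td -lt0n.
  move=> t d; rewrite recolorE; case: ifP => [tA|_] /andP[d0].
    rewrite leq_eqVlt => /predU1P[->|dc]; first by exists t; rewrite recolorE tA.
    have [|p [q [_ _ qd]]] := first_free_below ff (d := d); first by rewrite d0.
    by exists q; apply: keep.
  by move=> dt; have [|q qd] := cont t d; [rewrite d0 | exists q; apply: keep].
move=> p q pqM; rewrite !recolorE.
(* Pairs of [M] are equal or disjoint, and an unmatched [r] lies in none of them. *)
have -> : (p \in A) = (q \in A).
  case: rs => [[sr rM]|rsM].
    have nr t : t \in [set p; q] -> (t \in A) = false.
      move=> tpq; apply: contraNF rM; rewrite /A sr setUid => /set1P <-.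
      by apply/bigcupP; exists [set p; q].
    by rewrite !nr ?set21 ?set22.
  have same t : t \in [set p; q] -> t \in A -> [set p; q] = A.
    move=> tpq tA; apply/eqP; apply: contraT => ne.
    have := disjointFr (trivIsetP trivM _ _ pqM rsM ne) tpq.
    by rewrite tA.
  by apply/idP/idP => /same <-; rewrite ?set21 ?set22.
by case: ifP => // _; apply: mono.
Qed.

(** [B] is an additional property, such as a bound on the colors, carried along with the
    invariant. *)
Lemma good_loop chi psi' (B : {ffun I -> nat} -> Prop) :
  color_loop R M Q chi psi' ->
  (forall xi r s c, good psi Q M xi -> B xi -> r \in Q -> s \in Q ->
     xi r = 0 -> xi s = 0 -> s = r \/ [set r; s] \in M ->
     first_free R xi [set r; s] c ->
     good psi Q M (recolor xi [set r; s] c) -> B (recolor xi [set r; s] c)) ->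
  good psi Q M chi -> B chi ->
  [/\ good psi Q M psi', B psi' & {in Q, forall r, psi' r != 0}].
Proof.
move=> loop stepB gchi Bchi.
have [||[]] := loop_invariant (J := fun xi => good psi Q M xi /\ B xi) loop => //.
move=> xi r s c [gxi Bxi] rQ r0 rs ff.
have [sQ s0 g'] := good_recolor gxi rQ r0 rs ff; split=> //.
by apply: stepB => //; case: rs => [[]|]; [left|right].
Qed.

End Loop.

Lemma matched_adj (adj : rel I) M r s :
  symmetric adj -> irreflexive adj -> matching adj M ->
  [set r; s] \in M -> adj r s.
Proof.
move=> sym irr [_ adjM] /adjM[p [q [pq E]]].
have npq : p != q by apply: contraTneq pq => ->; rewrite irr.
have: p \in [set r; s] by rewrite E set21.
have: q \in [set r; s] by rewrite E set22.
case/set2P=> Eq; case/set2P=> Ep; move: pq npq; rewrite Ep Eq ?eqxx //.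
by rewrite sym.
Qed.

Lemma compl_adj_sym P Q psi W : symmetric (compl_adj R P Q psi W).
Proof.
move=> r s; rewrite /compl_adj /conflict collide_sym eq_sym [psi r == _]eq_sym.
by rewrite [blocked _ _ _ _ _ s || _]orbC andbCA; congr [&& _, _, _ & ~~ (_ || (_ || _))];
  rewrite andbCA.
Qed.

Lemma compl_adj_irr P Q psi W : irreflexive (compl_adj R P Q psi W).
Proof. by move=> r; rewrite /compl_adj eqxx !andbF. Qed.

Lemma matching_mate M r s t : trivIset M ->
  (forall p q, [set p; q] \in M -> p != q) ->
  [set r; s] \in M -> [set r; t] \in M -> s = t.
Proof.
move=> trM ne rsM rtM.
have E : [set r; s] = [set r; t].
  apply/eqP; apply: contraT => /(trivIsetP trM _ _ rsM rtM) /disjointFr /(_ (set21 r s)).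
  by rewrite set21.
have: s \in [set r; t] by rewrite -E set22.
by case/set2P=> // sr; have := ne _ _ rsM; rewrite sr eqxx.
Qed.

(** * Copying the colors of matched partners *)

Section Copy.
Variables (P Q Q' W : {set I}) (M : {set {set I}}) (psi : {ffun I -> nat}) (a b : V).
Hypothesis support : forall r, (psi r != 0) = (r \in P).
Hypotheses (PQ : [disjoint P & Q]) (Q'Q : Q' \subset Q) (WPQ : W \subset P :|: Q').
Hypothesis Wab : {in W, forall r, underlying (R r) a b}.
Hypotheses (prop : proper_coloring psi) (cont : contiguous psi).
Hypothesis matchM : matching (compl_adj R P Q psi W) M.

Lemma matching_indep r s : [set r; s] \in M -> (r != s) && ~~ collide R r s.
Proof.
move=> rsM.
have /and4P[_ _ -> /norP[]] := matched_adj (compl_adj_sym _ _ _ _) (compl_adj_irr _ _ _ _) matchM rsM.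
by [].
Qed.

Lemma matching_uncolored r s : [set r; s] \in M -> psi s = 0 -> s \in Q'.
Proof.
move=> rsM s0.
have /and4P[_ sW _ _] := matched_adj (compl_adj_sym _ _ _ _) (compl_adj_irr _ _ _ _) matchM rsM.
by have := subsetP WPQ _ sW; rewrite inE -support s0.
Qed.

(** A copied color is proper against [P] because the matching avoids blocked pairs, and among new
    members because all of [W] lies on one edge. *)
Lemma good_copy : good psi Q' M (copy_colors P Q' M psi).
Proof.
have adjM r s : [set r; s] \in M -> compl_adj R P Q psi W r s.
  exact: matched_adj (compl_adj_sym _ _ _ _) (compl_adj_irr _ _ _ _) matchM.
have neM r s : [set r; s] \in M -> r != s by move=> /matching_indep /andP[].
have trM := matchM.1.
have P0 r : r \in P -> r \in Q' = false.
  by move=> rP; apply: contraFF (disjointFr PQ rP) => /(subsetP Q'Q).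
have Q0 r : r \in Q' -> psi r = 0.
  move=> rQ; apply/eqP; rewrite -[_ == _]negbK support; apply/negP=> /P0.
  by rewrite rQ.
have copyP r : r \in P -> copy_colors P Q' M psi r = psi r.
  by move=> /P0 rQ; rewrite ffunE rQ.
have copyN r : r \notin Q' -> copy_colors P Q' M psi r = psi r.
  by move=> /negPf rQ; rewrite ffunE rQ.
have copyQ r : r \in Q' -> copy_colors P Q' M psi r = 0 \/
    exists s, [/\ s \in P, [set r; s] \in M & copy_colors P Q' M psi r = psi s].
  move=> rQ; rewrite ffunE rQ; case: pickP => [s /andP[sP rsM]|_].
    by right; exists s.
  by left; apply: Q0.
have copyM r s : r \in Q' -> s \in P -> [set r; s] \in M ->
    copy_colors P Q' M psi r = psi s.
  move=> rQ sP rsM; rewrite ffunE rQ; case: pickP => [t /andP[tP rtM]|/(_ s)].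
    by rewrite (matching_mate trM neM rtM rsM).
  by rewrite sP rsM.
have blk r s t : r \in Q' -> s \in P -> [set r; s] \in M -> t \in P ->
    psi t = psi s -> ~~ collide R t r.
  move=> rQ sP /adjM /and4P[_ _ _ /norP[_ /norP[_ /norP[+ _]]]] tP ts.
  apply: contra => ctr; rewrite /blocked (subsetP Q'Q) // sP /=.
  by apply/existsP; exists t; rewrite tP ts eqxx.
split.
- split=> r; first by rewrite support; apply: copyP.
  by case rQ: (r \in Q'); [right | rewrite copyN ?rQ //; left].
- move=> r s rs crs.
  case rQ: (r \in Q'); case sQ: (s \in Q').
  + have [->//|[r1 [r1P rM ->]]] := copyQ r rQ.
    have [-> //|[s1 [s1P sM ->]]] := copyQ s sQ.
    move=> E; exfalso.
    (* Distinct new members have distinct mates; [r], its mate [r1] and the other mate [s1] would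
       then be three independent members on {a, b}. *)
    have nrs1 : r1 != s1.
      apply: contra_neq rs => E1; rewrite -E1 setUC in sM; rewrite setUC in rM.
      exact: matching_mate trM neM rM sM.
    have nc : ~~ collide R r1 s1.
      apply/negP=> /(prop nrs1) /(_ E) /eqP; rewrite -[_ == _]negbK support r1P //.
    have nr : ~~ collide R r r1 by have /andP[] := matching_indep rM.
    have ns : ~~ collide R s1 r by apply: blk rM s1P (esym E).
    have /and4P[rW r1W _ _] := adjM _ _ rM; have /and4P[_ s1W _ _] := adjM _ _ sM.
    have := three_on_edge (Wab rW) (Wab r1W) (Wab s1W).
    by rewrite (negPf nr) [collide R r s1]collide_sym (negPf ns) (negPf nc).
  + have [->//|[r1 [r1P rM ->]]] := copyQ r rQ; rewrite copyN ?sQ // => E.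
    have sP : s \in P by rewrite -support -E support.
    by have := blk _ _ _ rQ r1P rM sP (esym E); rewrite collide_sym crs.
  + have [-> //|[s1 [s1P sM ->]]] := copyQ s sQ; rewrite copyN ?rQ // => E.
    have rP : r \in P by rewrite -support E support.
    by have := blk _ _ _ sQ s1P sM rP E; rewrite crs.
  by rewrite !copyN ?rQ ?sQ //; apply: prop.
- move=> r d /andP[d0 dr].
  have [t td] : exists t, psi t = d.
    case rQ: (r \in Q'); last by apply: (cont (r := r)); rewrite d0 -copyN ?rQ.
    have [E|[s [_ _ E]]] := copyQ r rQ; first by move: dr; rewrite E; lia.
    by apply: (cont (r := s)); rewrite d0 -E.
  by exists t; rewrite copyP // -support td -lt0n.
move=> r s rsM; have /and4P[rW sW _ /norP[_ /norP[PP _]]] := adjM _ _ rsM.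
have srM : [set s; r] \in M by rewrite setUC.
case/setUP: (subsetP WPQ _ rW) => rin; case/setUP: (subsetP WPQ _ sW) => sin.
- by move: PP; rewrite !copyP // rin sin /= negbK => /eqP.
- by rewrite (copyM s r) // copyP.
- by rewrite (copyM r s) // copyP.
(* Two new members matched to each other have no mate in [P], so both keep the value 0. *)
have nP p q : q \in Q' -> [set p; q] \in M -> copy_colors P Q' M psi p = 0 \/ p \notin Q'.
  case pQ: (p \in Q'); last by right.
  move=> qQ pqM; left; have [//|[t [tP ptM _]]] := copyQ p pQ.
  by have := P0 t tP; rewrite -(matching_mate trM neM pqM ptM) qQ.
by case: (nP _ _ sin rsM) => [->|/negP//]; case: (nP _ _ rin srM) => [->|/negP//].
Qed.

End Copy.
End Dynamics.

(** * The run of the algorithm *)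

Section Run.
Variables (V I : finType) (R : I -> digraph V).
Implicit Types (P Q W A : {set I}) (M : {set {set I}}) (psi chi : {ffun I -> nat}).

(** Each step lowers the number of uncolored members of [Q]. *)
Lemma color_loop_exists (adj : rel I) M Q psi : matching adj M ->
  exists psi', color_loop R M Q psi psi'.
Proof.
case=> _ adjM; have [n] := ubnP #|[set r in Q | psi r == 0]|.
elim: n psi => // n IH psi le_n.
have [/forall_inP done|] := boolP [forall r in Q, psi r != 0].
  by exists psi; constructor.
rewrite negb_forall => /existsP[r]; rewrite negb_imply negbK => /andP[rQ /eqP r0].
have smaller A c : r \in A -> first_free R psi A c ->
    exists psi', color_loop R M Q (recolor psi A c) psi'.
  move=> rA [/andP[c0 _] _]; apply: IH; rewrite -ltnS; apply: leq_trans le_n.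
  rewrite ltnS; apply: proper_card; apply/properP; split.
    apply/subsetP=> s; rewrite !inE recolorE; case: ifP => _ /andP[-> //].
    by rewrite gtn_eqF.
  by exists r; rewrite !inE ?recolorE ?rA rQ ?r0 //= gtn_eqF.
have [rM|rM] := boolP (r \in cover M).
  have /bigcupP[p pM rp] := rM.
  have [s Ep] : exists s, p = [set r; s].
    have [a [b [_ E]]] := adjM p pM; move: rp; rewrite E => /set2P[]->.
      by exists b.
    by exists a; rewrite setUC.
  have [c cP] := first_free_exists R psi [set r; s].
  have [psi' H] := smaller _ c (set21 r s) cP.
  by exists psi'; apply: loop_pair H; rewrite // -Ep.
have [c cP] := first_free_exists R psi [set r].
have [psi' H] := smaller _ c (set11 r) cP.
by exists psi'; apply: loop_single H.
Qed.

Lemma maximum_matching_exists (adj : rel I) : exists M, maximum_matching adj M.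
Proof.
pose matchb M := trivIset M && [forall p in M, [exists r, exists s, adj r s && (p == [set r; s])]].
have mP M : reflect (matching adj M) (matchb M).
  apply: (iffP andP) => -[tM aM]; split=> //.
    move=> p pM; have /existsP[r /existsP[s /andP[rs /eqP E]]] := forall_inP aM p pM.
    by exists r, s.
  apply/forall_inP=> p /aM[r [s [rs E]]]; apply/existsP; exists r; apply/existsP.
  by exists s; rewrite rs E eqxx.
have m0 : matchb set0.
  by apply/mP; split=> [|p]; rewrite ?inE //; apply/trivIsetP=> A B; rewrite inE.
case: (@arg_maxnP _ set0 matchb (fun M : {set {set I}} => #|M|) m0) => M /mP mM max.
by exists M; split=> // M' /mP; apply: max.
Qed.

Lemma edge_step_exists e pre post P Q u v psi :
  exists psi', edge_step R e pre post P Q u v psi psi'.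
Proof.
have m0 : matching (fun _ _ : I => false) set0.
  by split=> [|p]; rewrite ?inE //; apply/trivIsetP=> A B; rewrite inE.
have [x x4|no] := pickP (type4 e pre post u v); last first.
  have [psi' H] := color_loop_exists Q psi m0.
  by exists psi'; apply: step_simple => // x; rewrite no.
have [M1 mM1] := maximum_matching_exists (compl_adj R P Q psi (on_edge R P u v :|: Q)).
have [psi1 H1] := color_loop_exists Q (copy_colors P Q M1 psi) mM1.1.
set Px := on_edge R P u x :\: on_edge R P u v; set Qx := on_edge R Q u x.
have [M2 mM2] := maximum_matching_exists (compl_adj R P Q psi (Px :|: Qx)).
have [chi H2] := color_loop_exists Qx (copy_colors P Qx M2 psi) mM2.1.
have [psi2 H3] := color_loop_exists Q chi m0.
exists (if ncolors psi1 (P :|: Q) <= ncolors psi2 (P :|: Q) then psi1 else psi2).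
by apply: (step_type4 x4); [exists M1 | exists M2, chi].
Qed.

Lemma greedy_from_exists e pre P post psi :
  exists psi', greedy_from R e pre P post psi psi'.
Proof.
elim: post pre P psi => [|[u v] post IH] pre P psi; first by exists psi; constructor.
set Q := on_edge R setT u v :\: P.
have [psi1 H1] := edge_step_exists e pre post P Q u v psi.
have [psi' H] := IH (rcons pre (u, v)) (P :|: Q) psi1.
by exists psi'; apply: greedy_edge H1 H.
Qed.

Lemma min_ncolors_exists A : exists k, min_ncolors R A k.
Proof.
have ex : exists k, exists2 psi, valid_coloring R A psi & ncolors psi A = k.
  (* Pairwise distinct colors are always valid; the successor avoids the value 0. *)
  pose psi : {ffun I -> nat} := [ffun r => (enum_rank r).+1].
  exists (ncolors psi A), psi => //; split=> [r _|r s _ _ rs _]; rewrite !ffunE //.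
  by apply: contra rs => /eqP[] /ord_inj /enum_rank_inj ->.
have [n] := ex; elim/ltn_ind: n => n IH Hn.
(* The colorings range over an infinite type, so the minimum is reached by descent with excluded
   middle. *)
have [[m mn Hm]|no] := classic (exists2 m, m < n &
  exists2 psi, valid_coloring R A psi & ncolors psi A = m); first exact: IH mn Hm.
exists n; split=> // psi psiP; rewrite leqNgt; apply/negP=> lt_n.
by apply: no; exists (ncolors psi A) => //; exists psi.
Qed.

(** Colors are renumbered by their positions in the list of distinct colors. *)
Lemma bounded_coloring psi k :
  valid_coloring R setT psi -> ncolors psi setT = k ->
  exists f : I -> 'I_k, forall r s, r != s -> f r = f s -> ~~ collide R r s.
Proof.
move=> [_ val] <-.
have lt r : index (psi r) (undup [seq psi s | s in setT]) < ncolors psi setT.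
  by rewrite index_mem mem_undup; apply/imageP; exists r; rewrite // inE.
exists (fun r => Ordinal (lt r)) => r s rs [E].
apply/negP=> crs; have /negP := val r s (in_setT r) (in_setT s) rs crs.
apply; apply/eqP.
have mem t : psi t \in undup [seq psi s | s in setT].
  by rewrite mem_undup; apply/imageP; exists t; rewrite // inE.
by rewrite -(nth_index 0 (mem r)) E nth_index.
Qed.

End Run.

(** * Explored subtrees, collisions and the bound 5k/2 *)

Section Greedy.
Variables (V I : finType) (e : rel V) (R : I -> digraph V).
Hypothesis tree_e : is_tree [set: V] e.
Hypothesis deg_e : max_degree_le e 3.
Hypothesis subtree_R : forall r, rooted_subtree e (R r).
Variables (k : nat) (f : I -> 'I_k).
Hypothesis f_proper : forall r s, r != s -> f r = f s -> ~~ collide R r s.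
Implicit Types (P Q W A : {set I}) (M : {set {set I}}) (psi chi : {ffun I -> nat}).
Implicit Types (r s t : I).

Let sym_e : symmetric e. Proof. by case: tree_e => _ []. Qed.
Let irr_e : irreflexive e. Proof. by case: tree_e => _ []. Qed.
Let acyc_e (c : seq V) : 2 < size c -> ~ ucycle e c.
Proof. by case: tree_e => _ _ _ _; apply. Qed.
Let und_e r : subrel (underlying (R r)) e. Proof. by case: (subtree_R r). Qed.

Lemma underlying_connect r a b c d :
  underlying (R r) a b -> underlying (R r) c d -> connect (underlying (R r)) a c.
Proof.
case: (subtree_R r) => -[[_ _ inS conn _] _ _] _ ab cd.
have /andP[aS _] := inS _ _ ab; have /andP[cS _] := inS _ _ cd.
exact: conn aS cS.
Qed.

Lemma underlying_flip r a b : underlying (R r) a b = underlying (R r) b a.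
Proof. exact: underlying_sym. Qed.

(** This is the set of members colored once the edges of [pre] are treated. *)
Definition touched (pre : seq (V * V)) : {set I} :=
  [set r | [exists a, exists b, underlying (R r) a b && listed pre a b]].

Lemma touchedP pre r :
  reflect (exists a b, underlying (R r) a b /\ listed pre a b) (r \in touched pre).
Proof.
rewrite inE; apply: (iffP existsP) => [[a /existsP[b /andP[ab pab]]]|[a [b [ab pab]]]].
  by exists a, b.
by exists a; apply/existsP; exists b; rewrite ab pab.
Qed.

(* D is the set of vertices discovered by the edges in pre. *)
Record explored (D : {set V}) (pre post : seq (V * V)) : Prop := Explored {
  explored_grows : grows e D post;
  explored_connect : {in D &, forall x y, connect (listed pre) x y};
  explored_sub : forall a b, listed pre a b -> a \in D /\ e a b;
  explored_all : forall a b, e a b -> listed (pre ++ post) a b }.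

Record colored P psi : Prop := Colored {
  colored_support : forall r, (psi r != 0) = (r \in P);
  colored_proper : proper_coloring R psi;
  colored_contiguous : contiguous psi }.

Lemma good_colored P Q Q' M psi chi : colored P psi -> Q' \subset Q ->
  good R psi Q' M chi -> {in Q, forall r, chi r != 0} -> colored (P :|: Q) chi.
Proof.
move=> [supp _ _] sQ [[ext1 ext2] prop cont _] nzQ; split=> // r.
rewrite inE -supp; apply/idP/orP => [/ext2[]|[r0|/nzQ //]]; first by left.
  by move/(subsetP sQ); right.
by rewrite ext1.
Qed.

Lemma good_start P psi Q : colored P psi -> good R psi Q set0 psi.
Proof.
case=> supp prop cont; split=> //; last by move=> r s; rewrite inE.
by split=> // r; left.
Qed.

(** Whatever collides with a new member contains {u, v}, so first-fit never exceeds the load of that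
    edge, at most 2k. Members of [Q] already in [P] are exempt from [near], since part of [Q] may
    have been colored before. *)
Lemma first_fit_bound P Q psi psi' u v : colored P psi ->
  {in Q, forall r, underlying (R r) u v} ->
  (forall r t, r \in Q -> r \notin P -> t \in P :|: Q -> collide R t r ->
     underlying (R t) u v) ->
  (forall r, 2 * psi r <= 5 * k) ->
  first_fit_all R Q psi psi' ->
  colored (P :|: Q) psi' /\ forall r, 2 * psi' r <= 5 * k.
Proof.
move=> col Quv near bound ff.
have triv0 : trivIset (set0 : {set {set I}}) by apply/trivIsetP=> A B; rewrite inE.
have [||||g b nz] := good_loop (M := set0) (Q := Q) (psi := psi) (chi := psi)
  (B := fun xi => forall r, 2 * xi r <= 5 * k) _ _ _ ff _ (good_start Q col) bound => //.
- by move=> r s; rewrite inE.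
- by move=> r s; rewrite inE.
- move=> xi r s c [[ext1 ext2] _ _ _] bxi rQ sQ r0 s0 rs cP _ t.
  have {rs}sr : s = r by case: rs => //; rewrite inE.
  rewrite recolorE; case: ifP => // _; rewrite {}sr setUid in cP *.
  have rP : r \notin P.
    by rewrite -(colored_support col); apply/negP=> r1; move: (r1); rewrite -ext1 // r0.
  (* Every color up to [c] occurs on {u, v}: the smaller ones on members colliding with [r], and [c]
     on [r] itself. *)
  have cW d : 0 < d <= c -> exists2 t, t \in on_edge R setT u v :|: set0 &
      recolor xi [set r] c t = d.
    case/andP=> d0; rewrite leq_eqVlt => /predU1P[->|dc].
      by exists r; rewrite ?recolorE !inE ?eqxx ?Quv.
    have [|p [q [/set1P-> qr qd]]] := first_free_below cP (d := d).
      by rewrite d0.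
    have q0 : xi q != 0 by rewrite qd -lt0n.
    exists q; last first.
      by rewrite recolorE ifN // inE; apply: contra_neq q0 => ->.
    rewrite !inE orbF /=; apply: near qr => //.
    by rewrite inE -(colored_support col); apply/orP/ext2.
  have vac (F : {set I} -> Prop) : {in set0, forall A, F A} by move=> A; rewrite inE.
  have := matched_colors triv0 (vac _) (vac _) cW.
  have : #|on_edge R [set: I] u v| <= 2 * k.
    by apply: (load_bound f_proper (a := u) (b := v)) => p; rewrite inE => /andP[].
  rewrite !cards0; lia.
by split=> //; apply: good_colored g nz.
Qed.

(** The member reaches a discovered vertex [d] other than [u]. Explored edges also lead from [u] to
    [d], and in a tree both routes start with the same edge. *)
Lemma through D pre post t u y : explored D pre post -> u \in D ->
  t \in touched pre -> underlying (R t) u y ->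
  exists w d, [/\ listed pre u w, underlying (R t) u w,
    connect (listed pre) u d & connect (underlying (R t)) u d /\ u != d].
Proof.
move=> ex uD /touchedP[a [b [tab pab]]] tuy.
have [d [d' [tdd pdd ud]]] : exists d d',
    [/\ underlying (R t) d d', listed pre d d' & u != d].
  have [ua|ua] := eqVneq u a; last by exists a, b.
  exists b, a; split; [by rewrite underlying_flip | by rewrite listed_sym |].
  by apply: contraTneq (und_e tab) => <-; rewrite ua irr_e.
have cpd : connect (listed pre) u d.
  by apply: (explored_connect ex) => //; have [] := explored_sub ex pdd.
have ctd : connect (underlying (R t)) u d := underlying_connect tuy tdd.
have spre : subrel (listed pre) e by move=> p q /(explored_sub ex)[].
(* The empty graph is taken for [h], with the trivial path from [u] to itself. *)
have [] := @collision_at V e sym_e irr_e acyc_e (fun _ _ => false) (listed pre)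
  (underlying (R t)) u d u => //.
- exact: underlying_sym.
- by rewrite (sym_connect_sym (underlying_sym (R t))).
by move=> w puw tuw; exists w, d.
Qed.

(** From [u], [r] reaches the collision without explored edges, while [t] joins the collision to the
    explored part. So [t] passes through the first edge of the path of [r], and [through] then gives
    an explored edge of [t] at [u]. *)
Lemma collision_edge D pre post r t u v : explored D pre post -> u \in D ->
  underlying (R r) u v -> r \notin touched pre -> t \in touched pre ->
  collide R t r ->
  exists y w, [/\ underlying (R r) u y, underlying (R t) u y,
    ~~ listed pre u y, listed pre u w & underlying (R t) u w].
Proof.
move=> ex uD ruv rP tP ctr.
have r_pre x y : underlying (R r) x y -> ~~ listed pre x y.
  by move=> rxy; apply: contra rP => pxy; apply/touchedP; exists x, y.
suff [y ruy tuy] : exists2 y, underlying (R r) u y & underlying (R t) u y.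
  have [w [_ [puw tuw _ _]]] := through ex uD tP tuy.
  by exists y, w; split; rewrite ?r_pre.
case/collideP: ctr => -[a b] tab rab.
have [c [c' [tcc rcc uc]]] : exists c c',
    [/\ underlying (R t) c c', underlying (R r) c c' & u != c].
  have [ua|ua] := eqVneq u a.
    exists b, a; rewrite /underlying tab rab !orbT; split=> //.
    apply: contraTneq (@und_e r a b _) => [<-|]; first by rewrite ua irr_e.
    by rewrite /underlying rab.
  by exists a, b; rewrite /underlying tab rab.
case/touchedP: (tP) => a0 [b0 [tab0 pab0]].
have spre : subrel (listed pre) e by move=> p q /(explored_sub ex)[].
apply: (@collision_at V e sym_e irr_e acyc_e (listed pre) (underlying (R r))
  (underlying (R t)) u c a0) => //.
- exact: listed_sym.
- exact: underlying_sym.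
- exact: underlying_connect ruv rcc.
- by apply: (explored_connect ex) => //; have [] := explored_sub ex pab0.
exact: underlying_connect tcc tab0.
Qed.

Lemma neighborsP u y : (y \in neighbors e u) = e u y.
Proof. by rewrite inE. Qed.

Lemma type4P pre post u v x : type4 e pre post u v x ->
  exists w, [/\ neighbors e u = [set v; w; x], listed pre u w & listed post u x].
Proof.
case/andP=> _ /existsP[w /and3P[/eqP nE pw px]]; by exists w.
Qed.

(** * One edge of the run *)

Section Step.
Variables (D : {set V}) (pre post : seq (V * V)) (u v : V).
Hypothesis ex : explored D pre ((u, v) :: post).

Let uD : u \in D. Proof. by case/and4P: (explored_grows ex). Qed.
Let vD : v \notin D. Proof. by case/and4P: (explored_grows ex). Qed.
Let euv : e u v. Proof. by case/and4P: (explored_grows ex). Qed.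

Lemma pre_in y : listed pre u y -> y \in D.
Proof. by rewrite listed_sym => /(explored_sub ex)[]. Qed.

Lemma explored_step : explored (v |: D) (rcons pre (u, v)) post.
Proof.
have /and4P[_ _ _ gpost] := explored_grows ex.
have sub a b : listed (rcons pre (u, v)) a b ->
    listed pre a b \/ ((a == u) && (b == v) || (a == v) && (b == u)).
  rewrite -cats1 listed_cat => /orP[->|]; first by left.
  by rewrite /listed !inE !xpair_eqE [(b == u) && _]andbC; right.
split=> //.
- apply: (connect_grow (h := listed pre) (u := u)) => //.
  + exact: explored_connect ex.
  + by move=> a b; rewrite -cats1 listed_cat => ->.
  + exact: listed_sym.
  by rewrite /listed mem_rcons inE eqxx.
- move=> a b /sub[/(explored_sub ex)[aD eab]|]; first by rewrite inE aD orbT.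
  by case/orP=> /andP[/eqP-> /eqP->]; rewrite !inE ?uD ?eqxx ?orbT // sym_e.
by move=> a b eab; rewrite cat_rcons; apply: explored_all ex _ _ eab.
Qed.

Lemma touched_step :
  touched (rcons pre (u, v)) = touched pre :|: (on_edge R setT u v :\: touched pre).
Proof.
apply/setP=> r; rewrite in_setU in_setD orb_andr orbN /=.
apply/touchedP/orP => [[a [b [rab]]]|].
  rewrite -cats1 listed_cat => /orP[pab|].
    by left; apply/touchedP; exists a, b.
  rewrite /listed !inE => /orP[]/eqP[E1 E2]; right.
    by rewrite -E1 -E2.
  by rewrite -E1 -E2 underlying_flip.
have uv : listed (rcons pre (u, v)) u v by rewrite /listed mem_rcons inE eqxx.
case=> [/touchedP[a [b [rab pab]]]|]; last first.
  by rewrite !inE /= => ruv; exists u, v.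
by exists a, b; split; rewrite // -cats1 listed_cat pab.
Qed.

Let P := touched pre.
Let Q := on_edge R setT u v :\: P.

Lemma Q_edge r : r \in Q -> underlying (R r) u v.
Proof. by rewrite !inE => /andP[]. Qed.

Lemma PQ_disjoint : [disjoint P & Q].
Proof. by rewrite disjoint_sym; apply/pred0Pn=> -[r /andP[/= /setDP[_ /negP]]]. Qed.

(** If the shared edge {u, y} were not {u, v}, then [v], [w], [y] would be all neighbors of [u] by
    the degree bound, with {u, w} explored and {u, y} still to come: type 4. *)
Lemma simple_near r t : (forall x, ~~ type4 e pre post u v x) ->
  r \in Q -> t \in P -> collide R t r -> underlying (R t) u v.
Proof.
move=> no4 rQ tP ctr; have ruv := Q_edge rQ.
have rP : r \notin P by case/setDP: rQ.
have [y [w [ruy tuy npy puw tuw]]] := collision_edge ex uD ruv rP tP ctr.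
have [vy|vy] := eqVneq v y; first by rewrite vy.
have vw : v != w by apply: contraNneq vD => ->; apply: pre_in.
have wy : w != y by apply: contraNneq npy => <-.
have c3 : #|[set v; w; y]| = 3.
  by rewrite setUC cardsU1 cards2 !inE vw ![y == _]eq_sym (negPf vy) (negPf wy).
have nE : [set v; w; y] = neighbors e u.
  apply/eqP; rewrite eqEcard; apply/andP; split.
    apply/subsetP=> z; rewrite neighborsP !inE -orbA => /or3P[]/eqP-> //.
      exact: und_e tuw.
    exact: und_e tuy.
  by rewrite (leq_trans (deg_e u)) // c3.
case/negP: (no4 y); rewrite /type4 -nE; apply/andP; split.
  by rewrite c3.
apply/existsP; exists w; rewrite eqxx puw /=.
have := explored_all ex (und_e tuy); rewrite listed_cat (negPf npy) /=.
rewrite -cat1s listed_cat => /orP[|//].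
rewrite /listed !inE !xpair_eqE [y == v]eq_sym (negPf vy) !andbF /=.
by case/andP=> /eqP yu; have := und_e ruy; rewrite yu irr_e.
Qed.

(** * The three edges at [u] in type 4 *)

Section Type4.
Variables (x w : V).
Hypotheses (nE : neighbors e u = [set v; w; x]) (puw : listed pre u w)
  (pux : listed post u x).

(** An edge of [post] discovers a vertex outside [v |: D], whereas an explored edge has both ends in
    [D]. *)
Let npx : ~~ listed pre u x.
Proof.
have /and4P[_ _ _ gpost] := explored_grows ex.
apply/negP=> px; have xD := pre_in px.
by case/orP: pux => /(grows_new gpost); rewrite !inE ?uD ?xD orbT.
Qed.

Let pre_w y : listed pre u y -> y = w.
Proof.
move=> py; have: y \in neighbors e u by rewrite neighborsP; case: (explored_sub ex py).
rewrite nE !inE -orbA => /or3P[]/eqP // yE.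
  by have := pre_in py; rewrite yE (negPf vD).
by rewrite yE (negPf npx) in py.
Qed.

Lemma type4_near r t : r \in Q -> t \in P -> collide R t r ->
  underlying (R t) u v \/ (underlying (R r) u x /\ underlying (R t) u x).
Proof.
move=> rQ tP ctr; have ruv := Q_edge rQ.
have rP : r \notin P by case/setDP: rQ.
have [y [w' [ruy tuy npy _ _]]] := collision_edge ex uD ruv rP tP ctr.
have: y \in neighbors e u by rewrite neighborsP (und_e tuy).
rewrite nE !inE -orbA => /or3P[]/eqP yE.
- by left; rewrite -yE.
- by rewrite yE puw in npy.
by right; rewrite -yE.
Qed.

(** The only explored edge at [u] is {u, w}, so every colored member with an edge at [u] contains
    it. *)
Lemma type4_up t y : t \in P -> underlying (R t) u y -> underlying (R t) u w.
Proof.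
by move=> tP tuy; have [w' [d [/pre_w <-]]] := through ex uD tP tuy.
Qed.

End Type4.

(** Properness and contiguity suffice here: this coloring is adopted only if it uses no more colors
    than the other one. *)
Lemma process_edge1_colored psi psi' : colored P psi ->
  process_edge1 R P Q u v psi psi' -> colored (P :|: Q) psi'.
Proof.
move=> col [M [mM _] loop].
set W := _ :|: Q in mM.
have Wuv : {in W, forall r, underlying (R r) u v}.
  by move=> r /setUP[|/Q_edge //]; rewrite inE => /andP[].
have WPQ : W \subset P :|: Q.
  by apply: setSU; apply/subsetP=> r; rewrite inE => /andP[].
have gc := good_copy (colored_support col) PQ_disjoint (subxx Q) WPQ Wuv
  (colored_proper col) (colored_contiguous col) mM.
have [|||g _ nz] := good_loop mM.1 _ _ loop (B := fun=> True) _ gc Logic.I => //.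
- exact: matching_indep mM.
- exact: matching_uncolored (colored_support col) WPQ mM.
exact: good_colored col (subxx Q) g nz.
Qed.

(** Colors given in the matching phase are bounded through [matching_bound], those of the final
    first-fit phase through the load of {u, v}. *)
Lemma process_edge2_bound x psi psi' : type4 e pre post u v x -> colored P psi ->
  (forall r, 2 * psi r <= 5 * k) ->
  process_edge2 R P Q u v x psi psi' ->
  colored (P :|: Q) psi' /\ forall r, 2 * psi' r <= 5 * k.
Proof.
move=> /type4P[w [nE puw pux]] col bound [M [chi [mM loop ff]]].
set X := _ :\: _ in mM loop; set Z := on_edge R Q u x in mM loop.
pose Y := on_edge R P u v.
have sub_on A a b : on_edge R A a b \subset A.
  by apply/subsetP=> r; rewrite inE => /andP[].
have onE A a b r : r \in on_edge R A a b -> underlying (R r) a b.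
  by rewrite inE => /andP[].
have XP : X \subset P by apply: subset_trans (subsetDl _ _) (sub_on _ _ _).
have XY : [disjoint X & Y].
  by rewrite disjoint_sym; apply/pred0Pn=> -[r /andP[/= rY /setDP[_ /negP]]].
have XYw : {in X :|: Y, forall r, underlying (R r) u w}.
  move=> r /setUP[rX|rY].
    have /setDP[rx _] := rX.
    exact (type4_up nE pux (subsetP XP _ rX) (onE _ _ _ _ rx)).
  exact (type4_up nE pux (subsetP (sub_on _ _ _) _ rY) (onE _ _ _ _ rY)).
have YZv : {in Y :|: Z, forall r, underlying (R r) u v}.
  by move=> r /setUP[/onE //|/(subsetP (sub_on _ _ _)) /Q_edge].
have XZx : {in X :|: Z, forall r, underlying (R r) u x}.
  by move=> r /setUP[/setDP[/onE]|/onE].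
have near r t : r \in Z -> t \in P -> collide R t r -> t \in X :|: Y.
  have on_edgeE a b : (t \in on_edge R P a b) = (t \in P) && underlying (R t) a b.
    by rewrite inE.
  move=> rZ tP ctr; rewrite in_setU in_setD !on_edgeE tP /=.
  case: (underlying (R t) u v) (type4_near nE puw (subsetP (sub_on _ _ _) _ rZ) tP ctr).
    by rewrite orbT.
  by case=> // -[_ ->].
have psiP : {in P &, forall r s, r != s -> psi r = psi s -> ~~ collide R r s}.
  move=> r s rP _ rs E; apply/negP=> crs.
  have /eqP := colored_proper col rs crs E.
  by rewrite -[_ == _]negbK (colored_support col) rP.
have WPQ : X :|: Z \subset P :|: Z by apply: setSU.
have gc := good_copy (colored_support col) PQ_disjoint (sub_on Q u x) WPQ XZx
  (colored_proper col) (colored_contiguous col) mM.1.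
have count := matching_bound f_proper XP (sub_on P u v) (sub_on Q u x) PQ_disjoint
  XY XYw YZv XZx near psiP mM.
have [||||g bchi nz] := good_loop mM.1.1 _ _ loop
  (B := fun xi => forall r, 2 * xi r <= 5 * k) _ gc _ => //.
- exact: matching_indep mM.1.
- exact: matching_uncolored (colored_support col) WPQ mM.1.
- move=> xi r s c [[ext1 ext2] _ _ _] bxi rZ sZ r0 s0 _ cP [_ _ _ mono] t.
  rewrite recolorE; case: ifP => // _.
  have keep q : xi q != 0 -> recolor xi [set r; s] c q = xi q.
    move=> q0; rewrite recolorE ifN //; apply: contraNN q0.
    by case/set2P=> ->; rewrite ?r0 ?s0.
  (* A smaller color is held by a collider in [X], [Y] or [Z]. If a holder in [Y] has a color
     occurring in [X], a member of [X] replaces it, so only the rest of [Y] is counted. *)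
  have cW d : 0 < d <= c -> exists2 q,
      q \in X :|: Z :|: (Y :\: [set y in Y | [exists p in X, psi p == psi y]]) &
      recolor xi [set r; s] c q = d.
    case/andP=> d0; rewrite leq_eqVlt => /predU1P[->|dc].
      by exists r; rewrite ?recolorE ?set21 // !in_setU rZ orbT.
    have [|p [q [pA qp qd]]] := first_free_below cP (d := d); first by rewrite d0.
    have pZ : p \in Z by case/set2P: pA => ->.
    have q0 : xi q != 0 by rewrite qd -lt0n.
    have [q1|qZ] := ext2 q q0; last first.
      by exists q; rewrite ?keep // !in_setU qZ orbT.
    have qP : q \in P by rewrite -(colored_support col).
    case/setUP: (near _ _ pZ qP qp) => qin.
      by exists q; rewrite ?keep // !in_setU qin.
    have [/existsP[y /andP[yX /eqP yq]]|nq] := boolP [exists p in X, psi p == psi q].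
      have y1 : psi y != 0 by rewrite yq.
      exists y; first by rewrite !in_setU yX.
      by rewrite keep (ext1 y y1) // yq -(ext1 q q1).
    by exists q; rewrite ?keep // !(in_setU, in_setD) qin inE qin (negPf nq) orbT.
  have M2 : {in M, forall A, (A \subset X :|: Z) && (#|A| == 2)}.
    move=> A /mM.1.2[p [q [/and4P[pW qW pq _] ->]]].
    by rewrite cards2 pq subUset !sub1set pW qW.
  have monoM : {in M, forall A, {in A &, forall p q,
      recolor xi [set r; s] c p = recolor xi [set r; s] c q}}.
    move=> A AM; have [p [q [_ E]]] := mM.1.2 A AM; rewrite E in AM *.
    by move=> a b /set2P[]-> /set2P[]-> //; [|apply/esym]; apply: mono.
  have le_c := matched_colors mM.1.1 M2 monoM cW.
  (* This reads 2(c + |M|) <= 5k + 2|M|, and |M| cancels. *)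
  have := leq_trans (leq_mul (leqnn 2) le_c) count.
  by rewrite mulnDr leq_add2r.
- by move=> r; rewrite ffunE; case: ifP => // _; case: pickP.
have colchi := good_colored col (subxx Z) g nz.
have PZQ : P :|: Z :|: Q = P :|: Q by rewrite -setUA (setUidPr (sub_on _ _ _)).
(* The members left over avoid {u, x}, so by [type4_near] their colliders in [P] contain {u, v}. *)
rewrite -PZQ; apply: (first_fit_bound colchi Q_edge) bchi ff => r t rQ.
rewrite PZQ in_setU negb_or => /andP[_ rZ] /setUP[tP|/Q_edge //] ctr.
case: (type4_near nE puw rQ tP ctr) => // -[rx _].
by case/negP: rZ; rewrite inE rQ.
Qed.

Lemma edge_step_bound psi psi' : colored P psi -> (forall r, 2 * psi r <= 5 * k) ->
  edge_step R e pre post P Q u v psi psi' ->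
  colored (P :|: Q) psi' /\ forall r, 2 * psi' r <= 5 * k.
Proof.
move=> col bound; case=> [chi no4 ff|x psi1 psi2 t4 H1 H2].
  apply: (first_fit_bound col Q_edge) bound ff => r t rQ _.
  by case/setUP=> [tP|/Q_edge //]; apply: simple_near.
have col1 := process_edge1_colored col H1.
have [col2 bound2] := process_edge2_bound t4 col bound H2.
case: ifP => // le12; split=> // r.
(* When [psi1] is adopted, contiguity bounds its largest color by its number of colors, hence by
   that of [psi2]. *)
have le1 : psi1 r <= ncolors psi1 (P :|: Q).
  by apply: contiguous_le (colored_contiguous col1) _ => t; rewrite (colored_support col1).
have le2 : ncolors psi2 (P :|: Q) <= (5 * k)./2.
  apply: ncolors_le => t; rewrite -(colored_support col2) lt0n => ->.
  by have := bound2 t; lia.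
lia.
Qed.

End Step.

Lemma touched_all D pre : explored D pre [::] -> touched pre = with_edge R.
Proof.
move=> ex; apply/setP=> r; rewrite [RHS]inE; apply/touchedP/set0Pn.
  by case=> a [b [/orP[] rab _]]; [exists (a, b) | exists (b, a)].
case=> -[a b] rab; have uab : underlying (R r) a b by rewrite /underlying rab.
by exists a, b; split=> //; have := explored_all ex (und_e uab); rewrite cats0.
Qed.

Lemma greedy_bound D pre P post psi psi' :
  greedy_from R e pre P post psi psi' -> explored D pre post -> P = touched pre ->
  colored P psi -> (forall r, 2 * psi r <= 5 * k) ->
  colored (with_edge R) psi' /\ forall r, 2 * psi' r <= 5 * k.
Proof.
move=> run; elim: run D => {pre P post psi psi'}
  [pre P psi|pre P u v post psi psi1 psi' Q step _ IH] D ex EP col bound.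
  by rewrite -(touched_all ex) -EP.
have step' : edge_step R e pre post (touched pre)
    (on_edge R setT u v :\: touched pre) u v psi psi1 by rewrite -EP.
rewrite EP in col; have [col1 bound1] := edge_step_bound ex col bound step'.
apply: (IH (v |: D)) => //; last by rewrite /Q EP.
  exact: explored_step.
by rewrite touched_step // /Q EP.
Qed.

End Greedy.

(** * Existence of a run and the ratio against the optimum *)

Section Main.
Variables (V I : finType) (e : rel V) (R : I -> digraph V).
Hypothesis tree_e : is_tree [set: V] e.

(** Ensures that the statement about all runs is not vacuous. *)
Lemma greedy_col_exists : exists psi, greedy_col R e psi.
Proof.
have [root _] : exists root, root \in [set: V] by apply/set0Pn; case: tree_e.
have [//|E HE] := @bfs_exists V e [:: root] [set root].
  by move=> z; rewrite !inE.
have [psi Hpsi] := greedy_from_exists R e [::] set0 E [ffun => 0].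
by exists psi, E => //; exists root.
Qed.

Hypothesis deg_e : max_degree_le e 3.
Hypothesis subtree_R : forall r, rooted_subtree e (R r).

Lemma greedy_col_bound psi : greedy_col R e psi ->
  valid_coloring R (with_edge R) psi /\
  exists2 k, min_ncolors R setT k & ncolors psi (with_edge R) * 2 <= 5 * k.
Proof.
case=> E HE run; have [[root gE] allE] := bfs_order_listed tree_e HE.
have [k kP] := min_ncolors_exists R [set: I].
have [[opt optP kE] _] := kP.
have [f f_proper] := bounded_coloring optP kE.
have ex : explored e [set root] [::] E.
  by split=> // x y /set1P-> /set1P->.
have E0 : set0 = touched R [::].
  by apply/setP=> r; rewrite in_set0; apply/esym/touchedP=> -[a [b []]].
have col0 : colored R set0 [ffun=> 0].
  by split=> [r|r s|r d]; rewrite ?inE !ffunE //; lia.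
have bound0 r : 2 * ([ffun=> 0] : {ffun I -> nat}) r <= 5 * k by rewrite ffunE.
have [col bound] :=
  greedy_bound tree_e deg_e subtree_R f_proper run ex E0 col0 bound0.
split.
  split=> [r rW|r s rW _ rs crs]; first by rewrite lt0n (colored_support col).
  apply/eqP=> /(colored_proper col rs crs) /eqP.
  by rewrite -[_ == _]negbK (colored_support col) rW.
(* All colors lie in 1, ..., m with m the integer part of 5k/2, so there are at most m of them. *)
exists k => //; have : ncolors psi (with_edge R) <= (5 * k)./2; last by lia.
apply: ncolors_le => r; rewrite -(colored_support col) lt0n => ->.
by have := bound r; lia.
Qed.

End Main.

Local Open Scope ring_scope.

Theorem theorem1 (V I : finType) (e : rel V) (R : I -> digraph V)
    (tree_e : is_tree [set: V] e) (deg_e : max_degree_le e 3)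
    (subtree_R : forall r, rooted_subtree e (R r)) :
  (exists psi : {ffun I -> nat}, greedy_col R e psi) /\
  (forall psi : {ffun I -> nat}, greedy_col R e psi ->
     valid_coloring R (with_edge R) psi /\
     exists2 k : nat, min_ncolors R [set: I] k
       & (ncolors psi (with_edge R))%:R <= 5%:R / 2%:R * k%:R :> rat).
Proof.
split=> [|psi run]; first exact: greedy_col_exists tree_e.
have [valid [k kP le_k]] := greedy_col_bound tree_e deg_e subtree_R run.
split=> //; exists k => //.
by rewrite mulrAC ler_pdivlMr // -!natrM ler_nat.
Qed.
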